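(* Fix an integer $d\ge1$. There are constants $C_d,c_d>0$ such that, for all sufficiently large $n$, all integers $1\le m\le D(n,d)$, and independent uniform $\boldsymbol{z}^{(1)},\ldots,\boldsymbol{z}^{(m)}\in\mathbb{F}_2^{n-1}$, $$\mathbb{P}\left(\operatorname{rank}_{\mathbb{F}_2}\left[\Phi_d(\boldsymbol{z}^{(1)})\ \cdots\ \Phi_d(\boldsymbol{z}^{(m)})\right]<m\right)\le 2^{-(D(n,d)-m)}+C_d\,m\,2^{-(n-1)/2}+e^{-c_d(n-1)^d}.$$ The same bound holds for the probability that $M_m$ fails to have full row rank over $\mathbb{R}$, i.e. for $\mathbb{P}(\operatorname{rank}_{\mathbb{R}}M_m<m)$.
   Context: $D(n,d):=\sum_{j=0}^{d}\binom{n-1}{j}$. For $z\in\mathbb{F}_2^{n-1}$, $\Phi_d(z)=(z^S)_{S\subseteq[n-1],\,|S|\le d}\in\mathbb{F}_2^{D(n,d)}$, where $z^S=\prod_{j\in S}z_j$ (product in $\mathbb{F}_2$, with $z^\emptyset=1$); $[\Phi_d(\boldsymbol{z}^{(1)})\ \cdots\ \Phi_d(\boldsymbol{z}^{(m)})]$ is the matrix with these columns. For $S\subseteq[n-1]$ and $y\in\{\pm1\}^{n-1}$, $\chi_S(y)=\prod_{j\in S}y_j$ (with $\chi_\emptyset=1$). For independent uniform random points $\boldsymbol{y}^{(1)},\dots,\boldsymbol{y}^{(m)}$ of $\{\pm1\}^{n-1}$, $M_m=(\chi_S(\boldsymbol{y}^{(i)}))_{1\le i\le m,\ |S|\le d}\in\mathbb{R}^{m\times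 D(n,d)}$. *)

(* Defs.v *)
From mathcomp Require Import all_boot all_order all_algebra.
From mathcomp Require Import all_classical all_reals all_analysis.

Set Implicit Arguments.
Unset Strict Implicit.
Unset Printing Implicit Defensive.
Import Order.TTheory GRing.Theory Num.Theory.

Local Open Scope classical_set_scope.
Local Open Scope ring_scope.

Definition D (n d : nat) : nat := (\sum_(0 <= j < d.+1) 'C(n.-1, j))%N.

Definition small_sets (n d : nat) : {set {set 'I_n.-1}} :=
  [set S : {set 'I_n.-1} | (#|S| <= d)%N]%SET.

Lemma card_small_sets (n d : nat) : #|small_sets n d| = D n d.
Proof.
have binE k : 'C(n.-1, k) = #|[set S : {set 'I_n.-1} | #|S| == k]%SET|.
  by rewrite card_draws card_ord.
rewrite /D /small_sets; elim: d => [|d IHd].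
  by rewrite big_nat1 binE; apply: eq_card => S; rewrite !inE leqn0.
rewrite big_nat_recr //= -IHd binE.
rewrite -[LHS](cardID [pred S : {set 'I_n.-1} | (#|S| <= d)%N]).
congr addn; apply: eq_card => S; rewrite !inE /=.
  by case: (leqP #|S| d) => [/leqW->|]; rewrite ?andbF.
by rewrite -ltnNge -eqn_leq eq_sym.
Qed.

(* k |-> S is a bijection from 'I_(D n d) onto the sets S with #|S| <= d; it
   fixes the order of the coordinates, on which no rank depends. *)
Definition nth_small_set (n d : nat) (k : 'I_(D n d)) : {set 'I_n.-1} :=
  enum_val (cast_ord (esym (card_small_sets n d)) k).

Definition Phi (n d : nat) (z : 'rV['F_2]_n.-1) : 'cV['F_2]_(D n d) :=
  \col_k \prod_(j in nth_small_set k) z 0 j.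

Definition Phi_mx (n d m : nat) (z : 'I_m -> 'rV['F_2]_n.-1) :
    'M['F_2]_(D n d, m) :=
  \matrix_(k, i) Phi d (z i) k 0.

(* The two-element finite type {1, -1}, as a subtype of R. *)
Definition pm1 (R : realType) := seq_sub [:: 1; -1 : R].

Definition chi (R : realType) (n : nat) (S : {set 'I_n.-1})
    (y : 'rV[pm1 R]_n.-1) : R :=
  \prod_(j in S) val (y 0 j).

Definition chi_mx (R : realType) (n d m : nat) (y : 'I_m -> 'rV[pm1 R]_n.-1) :
    'M[R]_(m, D n d) :=
  \matrix_(i, k) chi (nth_small_set k) (y i).

(* V carries the discrete sigma-algebra, so X i is a random variable as soon as
   all preimages are measurable, and independence is the product rule over every
   subfamily J and all events A i. *)
Definition independent_uniform (R : realType) (disp : measure_display)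
    (T : measurableType disp) (P : probability T R) (V : finType) (m : nat)
    (X : 'I_m -> T -> V) : Prop :=
  [/\ forall (i : 'I_m) (A : set V), measurable (X i @^-1` A),
      forall (i : 'I_m) (v : V), P (X i @^-1` [set v]) = (#|V|%:R^-1)%:E
    & forall (J : {set 'I_m}) (A : 'I_m -> set V),
        P (\bigcap_(i in [set i | i \in J]) (X i @^-1` A i)) =
        (\prod_(i in J) P (X i @^-1` A i))%E].

Definition rank_bound (R : realType) (C c : R) (n d m : nat) : R :=
  2 ^- (D n d - m) + C * m%:R * 2 `^ (- (n.-1%:R / 2))
  + expR (- (c * n.-1%:R ^+ d)).

(* Main.v *)
Require Import Defs.
From HB Require Import structures.
From mathcomp Require Import all_boot all_order all_algebra.
From mathcomp Require Import mxabelem zify ring lra.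
From mathcomp Require Import all_classical all_reals all_analysis.

Set Implicit Arguments.
Unset Strict Implicit.
Unset Printing Implicit Defensive.
Import Order.TTheory GRing.Theory Num.Theory.

(** Write N = n - 1 and D = D n d, let p_c be the polynomial over F_2 with
    coefficient vector c, and let b(c), its bias, be the average of
    (-1)^(p_c(x)) over all points x.

    The number of polynomials p_c that vanish at all the sample points is
    2^(D - rank): always at least 2^(D - m), and at least twice as much when
    the rank is below m.  Its mean is the sum over c of ((1 + b(c)) / 2)^m, so
    the failure probability is at most the mean of (1 + b(c))^m over uniform c,
    minus 1 ([first_moment]).  The zero polynomial contributes exactly
    2^-(D - m); the other polynomials are sorted by bias ([sum_bias_split]).

    - If |b| <= 1/D, then (1 + b)^m <= 1 + m b + m^2 b^2.  The linear terms
      cancel because p and p + 1 have opposite biases, and b^2 has mean 2^-N.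
      This leaves m^2 2^-N, which is at most m 2^(-N/2) as soon as the latter
      is at most 1; otherwise the claimed bound exceeds 1.

    - If b > delta for a constant delta, a few random derivatives of p determine
      p (Bogdanov and Viola): their majority vote agrees with p up to an error
      below the minimum distance.  Derivatives have degree below d, so there are
      only 2^(O(N^(d-1))) such p if d >= 2 ([card_biased]), and each nonzero one
      still has 1 + b <= 2 - 2^(1-d), by the minimum distance again.  This last
      bound leaves no such p other than 0 if d = 1.

    - In between, the moment of b of order 2s is the probability that 2s random
      columns sum to zero.  Looking only at products of d coordinates taken from
      d disjoint blocks of 2h coordinates, with h of order N and s = h^(d-1),
      this forces a sum of 2s random rank-one tensors to vanish.  Once all factors
      but the last one are fixed, each unit of rank of the (d-1)-fold tensors
      costs a factor 2^(-2h).  That rank is rarely below s, because a random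
      rank-one tensor rarely falls into a subspace of dimension below h^(d-1)
      ([card_tensor_subspace]).  Hence the number of c with |b| > 1/D is at most
      2^D e^(-Omega(N^d)) ([card_biased_le]), which beats the factor
      (1 + delta)^D once delta is small.

    Over the reals, an m-minor of the monomial matrix of bits that is nonzero
    modulo 2 is an odd integer, hence nonzero in R, and monomials in the bits
    are linear combinations of characters of degree at most d.  So the real
    matrix is of full rank whenever the binary one is ([rank_Phi_le_chi]). *)

Local Open Scope ring_scope.

(** * Random rank-one tensors in a subspace over the two-element field *)

Lemma card_F2mx (m n : nat) : #|{: 'M['F_2]_(m, n)}| = (2 ^ (m * n))%N.
Proof. by rewrite card_mx card_Fp. Qed.

Lemma card_F2row (n : nat) : #|{: 'rV['F_2]_n}| = (2 ^ n)%N.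
Proof. by rewrite card_F2mx mul1n. Qed.

Lemma card_F2_rowg (p n : nat) (W : 'M['F_2]_(p, n)) :
  #|rowg W| = (2 ^ \rank W)%N.
Proof. by rewrite card_rowg card_Fp. Qed.

(** Averaging over a family of bijections of V leaves a count unchanged.  It is
    used with translations along one block of coordinates, which makes that
    block a fresh uniform vector while every other block stays fixed. *)
Lemma double_count_act (X V : finType) (act : X -> V -> V) (P : pred V) :
    (forall x, bijective (act x)) ->
  (#|X| * #|[set v | P v]%SET| = \sum_v #|[set x | P (act x v)]%SET|)%N.
Proof.
move=> bij_act.
transitivity (\sum_v \sum_x (P (act x v) : nat))%N; last first.
  by apply: eq_bigr => v _; rewrite -sum1dep_card [RHS]big_mkcond;
    apply: eq_bigr => x _; case: (P _).
rewrite exchange_big /= (eq_bigr (fun=> #|[set v | P v]%SET|)) ?sum_nat_const //.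
move=> x _; rewrite -sum1dep_card [RHS]big_mkcond [RHS](reindex (act x)) /=.
  by apply: eq_bigr => v _; case: (P _).
exact: onW_bij.
Qed.

Lemma card_mulmx_eq0 (B t n : nat) (M : 'M['F_2]_(t, n)) :
  (#|[set X : 'M['F_2]_(B, t) | X *m M == 0%R]%SET| <= 2 ^ (B * (t - \rank M)))%N.
Proof.
pose rows (X : 'M['F_2]_(B, t)) := [ffun i => row i X].
have rows_inj : injective rows.
  move=> X Y /ffunP eqXY; apply/row_matrixP => i.
  by have := eqXY i; rewrite !ffunE.
rewrite -(card_imset _ rows_inj).
apply: (@leq_trans #|[set f : {ffun 'I_B -> 'rV['F_2]_t} |
                       f \in ffun_on (rowg (kermx M))]%SET|).
  apply: subset_leq_card; apply/fintype.subsetP => f /imsetP[X].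
  rewrite !inE => /eqP XM0 ->; apply/ffun_onP => i.
  by rewrite ffunE mem_rowg; apply/sub_kermxP; rewrite -row_mul XM0 row0.
by rewrite cardsE card_ffun_on card_F2_rowg card_ord mxrank_ker -expnM mulnC.
Qed.

(** The vectors x_i (x) v_i, with v_i the rows of M and each x_i ranging over
    its fibre, add up to distinct elements of W because the v_i are independent.
    So W has at least the product of the fibre sizes as many elements. *)
Lemma rank_lb_of_fibres (h B s n p : nat) (M : 'M['F_2]_(s, n))
    (W : 'M['F_2]_(p, B * n)) :
    row_free M ->
    (forall i, 2 ^ h <= #|[set x : 'rV['F_2]_B |
                            (mxvec (x^T *m row i M) <= W)%MS]%SET|)%N ->
  (h * s <= \rank W)%N.
Proof.
move=> freeM fibM.
pose F i := [set x : 'rV['F_2]_B | (mxvec (x^T *m row i M) <= W)%MS]%SET.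
pose mx (f : {ffun 'I_s -> 'rV['F_2]_B}) := \matrix_i f i.
pose Psi f := mxvec ((mx f)^T *m M).
have PsiE f : Psi f = \sum_i mxvec ((f i)^T *m row i M).
  rewrite /Psi -linear_sum; congr mxvec; apply/matrixP => a b.
  rewrite !mxE summxE; apply: eq_bigr => i _.
  by rewrite !mxE big_ord1 !mxE.
have Psi_inj : injective Psi.
  move=> f g /(can_inj mxvecK)/(row_free_inj freeM)/trmx_inj/matrixP eqfg.
  by apply/ffunP => i; apply/rowP => a; have := eqfg i a; rewrite !mxE.
rewrite -(leq_exp2l (m := 2)) // -card_F2_rowg.
apply: (@leq_trans #|(family F : simpl_pred {ffun 'I_s -> 'rV['F_2]_B})|).
  rewrite card_family expnM -[X in (_ ^ X)%N](card_ord s) cardE /image_mem.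
  elim: (enum 'I_s) => //= i e IHe.
  by rewrite expnS leq_mul // fibM.
rewrite -(card_imset _ Psi_inj); apply: subset_leq_card.
apply/fintype.subsetP => v /imsetP[f /familyP fF ->].
rewrite mem_rowg PsiE; apply: summx_sub => i _.
by have := fF i; rewrite inE.
Qed.

Fixpoint tensor_dim (B k : nat) : nat :=
  if k is k'.+1 then (B * tensor_dim B k')%N else 1%N.

Definition block_sel (N B : nat) (beta : nat -> 'I_B -> 'I_N) (j : nat) :
    'M['F_2]_(B, N) :=
  \matrix_(a, i) (i == beta j a)%:R.

(** The iterated outer product of the first k blocks of coordinates of z.  The
    block number j is the image of [beta j]; its extraction is written as a
    product with [block_sel] so that translating one block is linear algebra. *)
Fixpoint tensor (N B : nat) (beta : nat -> 'I_B -> 'I_N) (k : nat)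
    (z : 'rV['F_2]_N) : 'rV['F_2]_(tensor_dim B k) :=
  if k is k'.+1 then mxvec ((z *m (block_sel beta k')^T)^T *m tensor beta k' z)
  else const_mx 1.

Definition disjoint_blocks (N B : nat) (beta : nat -> 'I_B -> 'I_N) (d : nat) :=
  forall j j' a a', (j < d)%N -> (j' < d)%N -> beta j a = beta j' a' ->
  j = j' /\ a = a'.

Section Tensor.
Variables (N B d : nat) (beta : nat -> 'I_B -> 'I_N).
Hypothesis beta_inj : disjoint_blocks beta d.

Lemma block_selE (j j' : nat) : (j < d)%N -> (j' < d)%N ->
  block_sel beta j *m (block_sel beta j')^T = if j == j' then 1%:M else 0.
Proof.
move=> jd j'd; apply/matrixP => a a'; rewrite !mxE.
rewrite (bigD1 (beta j a)) //= !mxE eqxx mul1r big1 ?addr0; last first.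
  by move=> i /negPf ia; rewrite !mxE ia mul0r.
case: ifP => [/eqP<-|/eqP jj'].
  rewrite mxE; congr (nat_of_bool _)%:R; apply/eqP/eqP => [|->//].
  by move=> /(beta_inj jd jd)[].
by rewrite mxE; case: eqP => // /(beta_inj jd j'd)[/jj'].
Qed.

Lemma tensor_shift (k j : nat) (z : 'rV['F_2]_N) (x : 'rV['F_2]_B) :
  (k <= j < d)%N -> tensor beta k (z + x *m block_sel beta j) = tensor beta k z.
Proof.
elim: k => [//|k IHk] /andP[kj jd] /=.
rewrite IHk ?jd ?(ltnW kj) // mulmxDl -mulmxA block_selE ?(ltn_trans kj) //.
by rewrite gtn_eqF // mulmx0 addr0.
Qed.

(** Call a k-fold tensor v bad if at least 2^h of the 2^(2h) vectors x satisfy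
    x (x) v in W.  By [rank_lb_of_fibres] the bad tensors span a space of
    dimension below h^k, so the first k blocks give a bad tensor with
    probability at most k 2^-h by induction; and if they do not, the next block
    puts the tensor in W with probability at most 2^-h. *)
Lemma card_tensor_subspace (h k p : nat) (W : 'M['F_2]_(p, tensor_dim B k)) :
    B = h.*2 -> (k <= d)%N -> (\rank W < h ^ k)%N ->
  (#|[set z | (tensor beta k z <= W)%MS]%SET| * 2 ^ h <= k * 2 ^ N)%N.
Proof.
move=> Bh; elim: k p W => [|k IHk] p W kd rankW.
  have W0 : W = 0 by apply/eqP; rewrite -mxrank_eq0 -leqn0 -ltnS.
  rewrite W0 mul0n leqn0 muln_eq0 cards_eq0; apply/orP; left.
  apply/eqP/setP => z; rewrite !inE /=.
  by apply/negP => /submx0null/rowP/(_ 0); rewrite !mxE => /eqP; rewrite oner_eq0.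
pose fib (v : 'rV_(tensor_dim B k)) :=
  [set x : 'rV['F_2]_B | (mxvec (x^T *m v) <= W)%MS]%SET.
pose bad := [set v | (2 ^ h <= #|fib v|)%N]%SET.
pose A : 'M['F_2]_(#|bad|, tensor_dim B k) := \matrix_(i < #|bad|) enum_val i.
have rankA : (\rank A < h ^ k)%N.
  have h0 : (0 < h)%N by move: rankW; rewrite expnS; case: (h).
  rewrite -(ltn_pmul2l h0) -expnS; apply: leq_ltn_trans rankW.
  apply: (rank_lb_of_fibres (M := rowsub (maxrankfun A) A)).
    exact: maxrowsub_free.
  move=> i; rewrite row_rowsub rowK.
  by have := enum_valP (maxrankfun A i); rewrite inE.
pose good_z z := (tensor beta k z \notin bad) && (tensor beta k.+1 z <= W)%MS.
have {IHk} IH := IHk _ A (ltnW kd) rankA.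
have good_bound : (#|[set z | good_z z]%SET| * 2 ^ h <= 2 ^ N)%N.
  pose act (x : 'rV['F_2]_B) z := z + x *m block_sel beta k.
  have act_bij x : bijective (act x).
    exists (fun z => z - x *m block_sel beta k) => z.
      by rewrite /act addrK.
    by rewrite /act subrK.
  have := double_count_act good_z act_bij; rewrite card_F2row => cnt.
  rewrite -(leq_pmul2r (expn_gt0 2 h : (0 < 2 ^ h)%N)).
  rewrite -mulnA -expnD addnn -Bh mulnC cnt -card_F2row -sum_nat_const.
  apply: leq_sum => z _.
  pose y := z *m (block_sel beta k)^T.
  have actE x : good_z (act x z) = (tensor beta k z \notin bad) &&
      (mxvec ((y + x)^T *m tensor beta k z) <= W)%MS.
    rewrite /good_z /act /= tensor_shift ?leqnn //.
    by rewrite mulmxDl -mulmxA block_selE // eqxx mulmx1.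
  have [bz|gz] := boolP (tensor beta k z \in bad).
    rewrite (_ : [set x | _]%SET = finset.set0) ?cards0 //.
    by apply/setP => x; rewrite !finset.in_set actE bz.
  have -> : [set x | good_z (act x z)]%SET =
      ((fun x => x - y) @: fib (tensor beta k z))%SET.
    apply/setP => x; rewrite finset.in_set actE gz /=.
    apply/idP/imsetP => [xW|[y' yW ->]].
      by exists (y + x); rewrite ?finset.in_set // addrAC subrr add0r.
    by move: yW; rewrite finset.in_set addrC subrK.
  rewrite card_imset; last exact: addIr.
  by rewrite finset.in_set -ltnNge in gz; apply: ltnW.
rewrite mulSn addnC; apply: leq_trans (leq_add IH good_bound).
rewrite -mulnDl leq_mul2r; apply/orP; right.
rewrite -cardsUI -[X in (X <= _)%N]addn0; apply: leq_add => //.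
apply: subset_leq_card; apply/fintype.subsetP => z; rewrite inE => zW.
rewrite finset.in_setU !finset.in_set /good_z zW andbT.
case: (boolP (_ \in bad)) => [zb|_]; last by rewrite orbT.
rewrite orbF.
have -> : tensor beta k z = row (enum_rank_in zb (tensor beta k z)) A.
  by rewrite rowK enum_rankK_in.
exact: row_sub.
Qed.

End Tensor.

(** * Vanishing sums of random rank-one tensors *)

Lemma sum_col_mx (A : nmodType) (t N : nat) (F : 'M['F_2]_(1 + t, N) -> A) :
  \sum_Z F Z = \sum_(Z : 'M['F_2]_(t, N)) \sum_(v : 'rV['F_2]_N) F (col_mx v Z).
Proof.
rewrite exchange_big pair_big /=.
rewrite (reindex (fun p : 'rV['F_2]_N * 'M['F_2]_(t, N) => col_mx p.1 p.2)) //=.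
exists (fun Z => (usubmx Z, dsubmx Z)) => [[v Z]|Z] _ /=.
  by rewrite col_mxKu col_mxKd.
by rewrite vsubmxK.
Qed.

Section Count.
Variables (N h d : nat) (beta : nat -> 'I_h.*2 -> 'I_N).
Hypothesis beta_inj : disjoint_blocks beta d.

Definition tensor_rows (k t : nat) (Z : 'M['F_2]_(t, N)) :
    'M['F_2]_(t, tensor_dim h.*2 k) :=
  \matrix_i tensor beta k (row i Z).

Lemma tensor_rows_col_mx (k t : nat) (v : 'rV['F_2]_N) (Z : 'M['F_2]_(t, N)) :
  tensor_rows k (col_mx v Z) = col_mx (tensor beta k v) (tensor_rows k Z).
Proof.
apply/row_matrixP => i; rewrite rowK.
case: (split_ordP i) => j ->; rewrite ?rowKu ?rowKd ?rowK.
  by rewrite ord1 !row_id.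
by [].
Qed.

Lemma rank_col_mx_row (t n : nat) (v : 'rV['F_2]_n) (M : 'M['F_2]_(t, n)) :
  \rank (col_mx v M) = (~~ (v <= M)%MS + \rank M)%N.
Proof.
rewrite -addsmxE; have [vM|vM] /= := boolP (v <= M)%MS.
  by rewrite add0n; case: (addsmx_idPr vM).
apply/eqP; rewrite eqn_leq; apply/andP; split.
  by rewrite (leq_trans (mxrank_adds_leqif _ _)) // leq_add2r rank_leq_row.
rewrite ltnNge; apply/negP => le_rk; case/negP: vM.
have /leqifP := mxrank_leqif_sup (addsmxSr v M).
have := mxrankS (addsmxSr v M).
case: ifP => [sub _ _|_ _]; first by rewrite (submx_trans (addsmxSl v M)).
by rewrite ltnNge le_rk.
Qed.

(** With B = h.*2, this is 2^(t (N + B)) times the mean of 2^(- B r), where r is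
    the rank of the k-fold tensors of t uniform points.  The exponential moment
    obeys a one-step recursion in t, which a tail bound on r would not. *)
Definition rank_moment (k t : nat) : nat :=
  \sum_(Z : 'M['F_2]_(t, N)) 2 ^ (h.*2 * (t - \rank (tensor_rows k Z))).

Lemma rank_momentS_crude (k t : nat) :
  (rank_moment k t.+1 <= 2 ^ N * 2 ^ h.*2 * rank_moment k t)%N.
Proof.
rewrite {1}/rank_moment -[t.+1]/(1 + t)%N sum_col_mx big_distrr /=.
apply: leq_sum => Z _; rewrite -mulnA -expnD -card_F2row -sum_nat_const.
apply: leq_sum => v _; rewrite tensor_rows_col_mx rank_col_mx_row.
rewrite leq_exp2l // -mulnS leq_mul2l; apply/orP; right; lia.
Qed.

(** A new point either falls in the span of the previous ones, which has small
    probability as long as t < h^k, or increases the rank by one. *)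
Lemma rank_momentS (k t : nat) : (k <= d)%N -> (t < h ^ k)%N ->
  (rank_moment k t.+1 <= 2 ^ N * (k.+1 * 2 ^ h) * rank_moment k t)%N.
Proof.
move=> kd tk.
rewrite {1}/rank_moment -[t.+1]/(1 + t)%N sum_col_mx big_distrr /=.
apply: leq_sum => Z _; set M := tensor_rows k Z; set r := \rank M.
have rt : (r <= t)%N by apply: rank_leq_row.
pose S := [set v | (tensor beta k v <= M)%MS]%SET.
have S_bound : (#|S| * 2 ^ h <= k * 2 ^ N)%N.
  by apply: (card_tensor_subspace beta_inj) => //; apply: leq_ltn_trans rt tk.
apply: (@leq_trans (\sum_v 2 ^ (h.*2 * (t - r)) *
                     (2 ^ h.*2 * (v \in S) + 1))%N).
  apply: leq_sum => v _; rewrite tensor_rows_col_mx rank_col_mx_row inE -/M -/r.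
  case: (_ <= _)%MS => /=.
    rewrite muln1 add0n subSn // mulnS expnD mulnC leq_mul2l.
    by apply/orP; right; rewrite leq_addr.
  by rewrite muln0 add0n muln1 subSS.
rewrite -big_distrr /= mulnC leq_mul2r; apply/orP; right.
rewrite big_split /= -big_distrr /= sum_nat_const muln1 card_F2row.
have -> : (\sum_v (v \in S : nat) = #|S|)%N.
  by rewrite -sum1_card [RHS]big_mkcond; apply: eq_bigr => v _; case: (v \in S).
rewrite -addnn expnD -mulnA.
have h1 : (1 <= 2 ^ h)%N by rewrite expn_gt0.
have := leq_mul2l (2 ^ h) (#|S| * 2 ^ h) (k * 2 ^ N); rewrite S_bound orbT.
have := leq_pmulr (2 ^ N) (h1 : 0 < 2 ^ h)%N.
nia.
Qed.

Lemma rank_moment_bound (k s s' : nat) : (k <= d)%N -> (s <= h ^ k)%N ->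
  (rank_moment k (s' + s) <=
    (2 ^ N * 2 ^ h.*2) ^ s' * (2 ^ N * (k.+1 * 2 ^ h)) ^ s)%N.
Proof.
move=> kd sk; elim: s' => [|s' IH]; last first.
  rewrite addSn (leq_trans (rank_momentS_crude _ _)) //.
  by rewrite expnS -[X in (_ <= X)%N]mulnA leq_mul2l IH orbT.
rewrite add0n expn0 mul1n; elim: s sk => [|s IH] sk.
  rewrite /rank_moment (eq_bigr (fun=> 1%N)) => [|Z _]; last first.
    by rewrite sub0n muln0.
  by rewrite sum1_card card_F2mx mul0n.
apply: leq_trans (rank_momentS kd sk) _.
by rewrite expnS leq_mul2l IH ?orbT // ltnW.
Qed.

(** Translating the block number k of the t points by the rows of X turns the
    sum of the tensors into an affine function of X, with linear part
    X^T *m [tensor_rows]; its kernel has an explicit size. *)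
Lemma card_tensor_sum_eq0 (k t : nat) : (k < d)%N ->
  (2 ^ (t * h.*2) * #|[set Z : 'M['F_2]_(t, N) |
      (\sum_i tensor beta k.+1 (row i Z))%R == 0%R]%SET| <= rank_moment k t)%N.
Proof.
move=> kd; set P := fun Z => _.
pose act (X : 'M['F_2]_(t, h.*2)) (Z : 'M['F_2]_(t, N)) :=
  Z + X *m block_sel beta k.
have act_bij X : bijective (act X).
  exists (fun Z => Z - X *m block_sel beta k) => Z.
    by rewrite /act addrK.
  by rewrite /act subrK.
rewrite -card_F2mx (double_count_act P act_bij); apply: leq_sum => Z _.
set M := tensor_rows k Z; pose Y := Z *m (block_sel beta k)^T.
have PE X : P (act X Z) = ((Y + X)^T *m M == 0).
  rewrite /P /= -linear_sum mxvec_eq0; congr (_ == _).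
  apply/matrixP => a b; rewrite summxE !mxE; apply: eq_bigr => i _.
  rewrite linearD /= row_mul (tensor_shift beta_inj) ?leqnn // mulmxDl -mulmxA.
  rewrite (block_selE beta_inj) // eqxx mulmx1 !mxE big_ord1 !mxE.
  by congr ((_ + _) * _); apply: eq_bigr => l _; rewrite !mxE.
rewrite (_ : [set X | _]%SET =
  ((fun X' : 'M['F_2]_(h.*2, t) => X'^T - Y) @:
    [set X' : 'M['F_2]_(h.*2, t) | X' *m M == 0%R])%SET).
  by rewrite (leq_trans (leq_imset_card _ _)) // card_mulmx_eq0.
apply/setP => X; rewrite finset.in_set PE; apply/idP/imsetP => [YX|[X']].
  exists (Y + X)^T; rewrite ?finset.in_set // trmxK.
  by rewrite addrAC subrr add0r.
by rewrite finset.in_set => /eqP X'M ->; rewrite addrC subrK trmxK X'M.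
Qed.

End Count.

(** * From tensors to monomials of bounded degree *)

Lemma exists_disjoint_blocks (N B d : nat) : (0 < N)%N -> (B * d <= N)%N ->
  exists beta : nat -> 'I_B -> 'I_N, disjoint_blocks beta d.
Proof.
move=> N0 BdN; exists (fun j a => insubd (Ordinal N0) (j * B + a)%N).
have val_beta j (a : 'I_B) : (j < d)%N -> (j * B + a < N)%N.
  move=> jd; apply: leq_trans BdN; rewrite mulnC.
  by apply: (@leq_trans (B * j.+1)); rewrite ?leq_mul2l ?jd ?orbT // mulnS addnC ltn_add2r.
move=> j j' a a' jd j'd /(congr1 val).
rewrite !val_insubd !val_beta // => eqja.
have B0 : (0 < B)%N by apply: leq_trans (ltn_ord a).
have jj' : j = j'.
  have := congr1 (divn^~ B) eqja.
  by rewrite /= !divnMDl // !divn_small // !addn0.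
by split=> //; apply/val_inj/eqP; rewrite -(eqn_add2l (j * B)) {2}jj' eqja.
Qed.

Lemma nth_small_set_surj (n d : nat) (S : {set 'I_n.-1}) : (#|S| <= d)%N ->
  exists k : 'I_(D n d), nth_small_set k = S.
Proof.
move=> Sd; have Sin : S \in small_sets n d by rewrite inE.
exists (cast_ord (card_small_sets n d) (enum_rank_in Sin S)).
by rewrite /nth_small_set cast_ordK enum_rankK_in.
Qed.

Lemma nth_small_set_inj (n d : nat) : injective (@nth_small_set n d).
Proof. by move=> k k' /enum_val_inj/cast_ord_inj. Qed.

Lemma card_nth_small_set (n d : nat) (k : 'I_(D n d)) :
  (#|nth_small_set k| <= d)%N.
Proof.
have := enum_valP (cast_ord (esym (card_small_sets n d)) k).
by rewrite finset.in_set.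
Qed.

(** Blocks are disjoint, so no coordinate is squared and an entry of the tensor
    is a multilinear monomial. *)
Lemma tensor_monomial (N B d k : nat) (beta : nat -> 'I_B -> 'I_N)
    (q : 'I_(tensor_dim B k)) :
    disjoint_blocks beta d -> (k <= d)%N ->
  exists S : {set 'I_N}, [/\ (#|S| <= k)%N,
    forall i, i \in S -> exists j a, (j < k)%N /\ i = beta j a
  & forall z, tensor beta k z 0 q = \prod_(i in S) z 0 i].
Proof.
move=> beta_inj; elim: k q => [|k IHk] q kd /=.
  exists finset.set0; split=> [|i|z]; rewrite ?cards0 ?inE //.
  by rewrite mxE big1 // => i; rewrite inE.
case/mxvec_indexP: q => a q.
have [S [cardS memS prodS]] := IHk q (ltnW kd).
have aS : beta k a \notin S.
  apply/negP => /memS[j [a' [jk]]] /(beta_inj _ _ _ _ kd (ltn_trans jk kd))[kj _].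
  by rewrite kj ltnn in jk.
exists (beta k a |: S)%SET; split=> [|i|z].
- by rewrite cardsU1 aS.
- rewrite finset.in_setU1 => /orP[/eqP->|/memS[j [a' [jk ->]]]].
    by exists k, a.
  by exists j, a'; rewrite leqW.
rewrite mxvecE !mxE big_ord1 !mxE prodS big_setU1 //=; congr (_ * _).
rewrite (bigD1 (beta k a)) //= !mxE eqxx mulr1 big1 ?addr0 // => i ia.
by rewrite !mxE (negPf ia) mulr0.
Qed.

(** The 2s points are split in two: the recursion gains a factor of order 2^-h
    for each of the first s points, where the span is still small, and the
    crude bound serves for the others. *)
Lemma card_Phi_sum_eq0 (n k h : nat) :
    (0 < h)%N -> (h.*2 * k.+1 <= n.-1)%N ->
  (#|[set Z : 'M['F_2]_(h ^ k + h ^ k, n.-1) |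
       (\sum_i Phi k.+1 (row i Z))%R == 0%R]%SET| * 2 ^ (h * h ^ k) <=
    (2 ^ n.-1) ^ (h ^ k + h ^ k) * k.+1 ^ (h ^ k))%N.
Proof.
move=> h0 hN; set s := (h ^ k)%N; set N := n.-1.
have N0 : (0 < N)%N by apply: leq_trans hN; rewrite muln_gt0 double_gt0 h0.
have [beta beta_inj] := exists_disjoint_blocks N0 hN.
set Q := [set Z | _]%SET.
pose Q' := [set Z : 'M['F_2]_(s + s, N) |
  (\sum_i tensor beta k.+1 (row i Z))%R == 0%R]%SET.
have QQ' : (#|Q| <= #|Q'|)%N.
  apply: subset_leq_card; apply/fintype.subsetP => Z.
  rewrite !finset.in_set => /eqP/colP SZ; apply/eqP/rowP => q.
  have [S [cardS _ prodS]] := tensor_monomial q beta_inj (leqnn k.+1).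
  have [kS kSE] := nth_small_set_surj cardS.
  have := SZ kS; rewrite !mxE !summxE => SZ0; rewrite -[RHS]SZ0.
  by apply: eq_bigr => i _; rewrite prodS mxE kSE.
have bound1 := card_tensor_sum_eq0 beta_inj (s + s) (leqnn k.+1).
have bound2 := rank_moment_bound beta_inj s (leqnSn k) (leqnn s).
have := leq_trans bound1 bound2; rewrite -/Q'.
have e3 : (0 < 2 ^ (3 * (h * s)))%N by rewrite expn_gt0.
move=> bound; rewrite -(leq_pmul2l e3).
apply: (@leq_trans (2 ^ ((s + s) * h.*2) * #|Q'|)).
  rewrite mulnCA mulnC -expnD.
  by rewrite leq_mul // leq_pexp2l //; lia.
apply: leq_trans bound _; rewrite !expnMn -!expnM [X in (_ <= X)%N]mulnA.
rewrite -[X in (X <= _)%N]mulnA; apply/eq_leq.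
rewrite [LHS](_ : _ = (2 ^ (N * s) * 2 ^ (h.*2 * s) * 2 ^ (N * s) * 2 ^ (h * s)) *
   k.+1 ^ s)%N; last by lia.
rewrite -!expnD; congr (2 ^ _ * _)%N; lia.
Qed.

(** * Boolean functions of bounded degree, through their derivatives *)

Definition fderiv (N : nat) (a : 'rV['F_2]_N) (f : {ffun 'rV['F_2]_N -> 'F_2}) :
    {ffun 'rV['F_2]_N -> 'F_2} :=
  [ffun x => f (x + a) - f x].

(** Degree less than k in the sense that all k-fold derivatives vanish.  This
    makes derivatives lower the degree by definition, and closure under
    translations immediate. *)
Fixpoint deg_lt (N k : nat) : {set {ffun 'rV['F_2]_N -> 'F_2}} :=
  if k is k'.+1 then [set f | [forall a, fderiv a f \in deg_lt N k']]%SET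
  else [set f : {ffun 'rV['F_2]_N -> 'F_2} | f == 0]%SET.

Section DegLt.
Variable N : nat.
Implicit Types (f g : {ffun 'rV['F_2]_N -> 'F_2}) (a x : 'rV['F_2]_N).

Lemma deg_ltSP k f :
  reflect (forall a, fderiv a f \in deg_lt N k) (f \in deg_lt N k.+1).
Proof. by rewrite /= finset.in_set; apply: forallP. Qed.

Lemma fderivD a f g : fderiv a (f + g) = fderiv a f + fderiv a g.
Proof. by apply/ffunP => x; rewrite !ffunE addrACA opprD. Qed.

Lemma fderiv0 a : fderiv a 0 = 0.
Proof. by apply/ffunP => x; rewrite !ffunE subrr. Qed.

Lemma deg_lt0 k : 0 \in deg_lt N k.
Proof.
elim: k => [|k IHk]; first by rewrite finset.inE.
by apply/deg_ltSP => a; rewrite fderiv0.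
Qed.

Lemma deg_ltD k f g :
  f \in deg_lt N k -> g \in deg_lt N k -> f + g \in deg_lt N k.
Proof.
elim: k f g => [|k IHk] f g.
  by rewrite !finset.inE => /eqP-> /eqP->; rewrite addr0.
move=> /deg_ltSP Df /deg_ltSP Dg; apply/deg_ltSP => a.
by rewrite fderivD IHk.
Qed.

Lemma deg_lt_sum k (I : Type) (r : seq I) (F : I -> {ffun 'rV['F_2]_N -> 'F_2}) :
  (forall i, F i \in deg_lt N k) -> \sum_(i <- r) F i \in deg_lt N k.
Proof.
move=> degF; elim/big_ind: _ => // [|f g]; [exact: deg_lt0|exact: deg_ltD].
Qed.

Lemma F2_cases (u : 'F_2) : (u = 0) \/ (u = 1).
Proof. by case: u => [[|[|//]] lt2]; [left|right]; apply: val_inj. Qed.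

Lemma F2_oppr (u : 'F_2) : - u = u.
Proof. by have [->|->] := F2_cases u; apply: val_inj. Qed.

Lemma deg_lt_scale k (c : 'F_2) f :
  f \in deg_lt N k -> [ffun x => c * f x] \in deg_lt N k.
Proof.
move=> degf; have [->|->] := F2_cases c.
  rewrite (_ : [ffun _ => _] = 0) ?deg_lt0 //.
  by apply/ffunP => x; rewrite !ffunE mul0r.
by rewrite (_ : [ffun _ => _] = f) //; apply/ffunP => x; rewrite !ffunE mul1r.
Qed.

Lemma deg_ltB k f g :
  f \in deg_lt N k -> g \in deg_lt N k -> f - g \in deg_lt N k.
Proof.
move=> degf /(deg_lt_scale (-1)) degg.
rewrite (_ : f - g = f + [ffun x => -1 * g x]) ?deg_ltD //.
by apply/ffunP => x; rewrite !ffunE mulN1r.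
Qed.

Lemma deg_lt_shift k a f :
  f \in deg_lt N k -> [ffun x => f (x + a)] \in deg_lt N k.
Proof.
elim: k f => [|k IHk] f.
  rewrite !finset.inE => /eqP->; apply/eqP/ffunP => x; by rewrite !ffunE.
move=> /deg_ltSP Df; apply/deg_ltSP => b.
rewrite (_ : fderiv b _ = [ffun x => fderiv b f (x + a)]); first exact: IHk.
by apply/ffunP => x; rewrite !ffunE addrAC.
Qed.

Lemma deg_ltS k f : f \in deg_lt N k -> f \in deg_lt N k.+1.
Proof.
elim: k f => [|k IHk] f.
  rewrite finset.inE => /eqP->; exact: deg_lt0.
by move=> /deg_ltSP Df; apply/deg_ltSP => a; apply: IHk.
Qed.

Lemma deg_lt_leq k l f : (k <= l)%N -> f \in deg_lt N k -> f \in deg_lt N l.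
Proof.
move=> /subnK<-; elim: (l - k)%N => // m IHm degf.
by rewrite addSn; apply/deg_ltS/IHm.
Qed.

(** Leibniz rule for x_j f. *)
Lemma deg_lt_mul_coord k (j : 'I_N) f :
  f \in deg_lt N k -> [ffun x : 'rV_N => x 0 j * f x] \in deg_lt N k.+1.
Proof.
elim: k f => [|k IHk] f.
  rewrite finset.inE => /eqP->; rewrite (_ : [ffun _ => _] = 0) ?deg_lt0 //.
  by apply/ffunP => x; rewrite !ffunE mulr0.
move=> degf; have /deg_ltSP Df := degf; apply/deg_ltSP => a.
rewrite (_ : fderiv a _ = [ffun x : 'rV_N => x 0 j * fderiv a f x] +
                          [ffun x => a 0 j * [ffun x => f (x + a)] x]).
  by apply: deg_ltD; [apply: IHk|apply/deg_lt_scale/deg_lt_shift].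
by apply/ffunP => x; rewrite !ffunE mxE; ring.
Qed.

Lemma deg_lt_monomial (S : {set 'I_N}) :
  [ffun x : 'rV_N => \prod_(i in S) x 0 i] \in deg_lt N #|S|.+1.
Proof.
have monom (s : seq 'I_N) :
    [ffun x : 'rV_N => \prod_(i <- s) x 0 i] \in deg_lt N (size s).+1.
  elim: s => [|i s IHs].
    apply/deg_ltSP => a; rewrite finset.inE; apply/eqP/ffunP => x.
    by rewrite !ffunE !big_nil subrr.
  have /(deg_lt_mul_coord i) := IHs.
  rewrite (_ : [ffun _ => _] = [ffun x : 'rV_N => \prod_(j <- i :: s) x 0 j]) //.
  by apply/ffunP => x; rewrite !ffunE big_cons.
have := monom (enum S); rewrite -cardE.
rewrite (_ : [ffun _ => _] = [ffun x : 'rV_N => \prod_(i in S) x 0 i]) //.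
by apply/ffunP => x; rewrite !ffunE big_enum.
Qed.

Lemma const_of_fderiv0 f : (forall a, fderiv a f = 0) -> forall x, f x = f 0.
Proof.
by move=> Df x; have /ffunP/(_ 0) := Df x; rewrite !ffunE add0r => /subr0_eq.
Qed.

(** Minimum distance of Reed-Muller codes: a point where the derivative of f
    along a is nonzero gives a nonzero value of f at x or at x + a, so the
    support of f is at least half that of any derivative. *)
Lemma weight_deg_lt (d : nat) f : f \in deg_lt N d.+1 -> f != 0 ->
  (2 ^ N <= 2 ^ d * #|[set x | f x != 0%R]%SET|)%N.
Proof.
have const_weight g : (forall a, fderiv a g = 0) -> g != 0 ->
    #|[set x | g x != 0]%SET| = (2 ^ N)%N.
  move=> Dg g0; rewrite -card_F2row -cardsT; congr #|pred_of_set _|.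
  apply/setP => x; rewrite !finset.inE; apply: contraNneq g0 => gx0.
  by apply/eqP/ffunP => y; rewrite !ffunE !(const_of_fderiv0 Dg y) -(const_of_fderiv0 Dg x).
elim: d f => [|d IHd] f.
  move=> /deg_ltSP Df f0; rewrite const_weight ?mul1n // => a.
  by have := Df a; rewrite finset.inE => /eqP.
move=> /deg_ltSP Df f0.
have [/existsP[a Daf]|/existsPn noD] := boolP [exists a, fderiv a f != 0]; last first.
  rewrite const_weight ?leq_pmull ?expn_gt0 // => a.
  by have := noD a; rewrite negbK => /eqP.
apply: leq_trans (IHd _ (Df a) Daf) _.
rewrite expnS [(2 * _)%N]mulnC -mulnA leq_mul2l mul2n; apply/orP; right.
set S := [set x | f x != 0]%SET.
have shiftS : #|[set x | f (x + a) != 0]%SET| = #|S|.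
  rewrite -[RHS](card_imset _ (addIr (- a))); congr #|pred_of_set _|.
  apply/setP => x; rewrite finset.inE; apply/idP/imsetP => [fx|[y]].
    by exists (x + a); rewrite ?finset.inE // addrK.
  by rewrite finset.inE => fy ->; rewrite subrK.
rewrite -addnn -[X in (_ <= X + _)%N]shiftS.
apply: leq_trans (leq_subr #|([set x | f (x + a) != 0] :&: S)%SET| _).
rewrite -cardsU; apply: subset_leq_card; apply/fintype.subsetP => x.
rewrite !finset.inE ffunE; apply: contraNT; rewrite negb_or !negbK.
by move=> /andP[/eqP-> /eqP->]; rewrite subrr.
Qed.

(** A function is determined by its value at 0 and its derivatives along the N
    unit vectors. *)
Lemma card_deg_ltS k : (#|deg_lt N k.+1| <= 2 * #|deg_lt N k| ^ N)%N.
Proof.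
pose key f := (f 0, [ffun i : 'I_N => fderiv (delta_mx 0 i) f]).
have key_inj : injective key.
  move=> f g [fg0 /ffunP Dfg]; apply/ffunP => x.
  rewrite [x]row_sum_delta.
  elim: (index_enum _) => [|i r IHr]; first by rewrite big_nil.
  rewrite big_cons addrC; have [->|->] := F2_cases (x 0 i).
    by rewrite scale0r addr0.
  rewrite scale1r; have := Dfg i; rewrite !ffunE.
  move=> /ffunP/(_ (\sum_(j <- r) x 0 j *: delta_mx 0 j)).
  by rewrite !ffunE IHr => /addIr.
rewrite -(card_imset _ key_inj).
apply: (@leq_trans #|finset.setX [set: 'F_2]%SET
   [set D : {ffun 'I_N -> _} | D \in ffun_on (deg_lt N k)]%SET|).
  apply: subset_leq_card; apply/fintype.subsetP => p /imsetP[f /deg_ltSP Df ->].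
  by rewrite !finset.inE /=; apply/ffun_onP => i; rewrite ffunE.
by rewrite finset.cardsX cardsT card_Fp // cardsE card_ffun_on card_ord.
Qed.

Lemma card_deg_lt k : (#|deg_lt N k.+1| <= 2 ^ (N.+1 ^ k))%N.
Proof.
have step l L : (#|deg_lt N l| <= 2 ^ L -> #|deg_lt N l.+1| <= 2 ^ (1 + L * N))%N.
  move=> le_l; apply: leq_trans (card_deg_ltS l) _.
  rewrite expnD expn1 leq_mul2l expnM; apply/orP; right.
  by move: #|_| (2 ^ L)%N le_l => b c; elim: N => // e IHe bc; rewrite !expnS leq_mul ?IHe.
elim: k => [|k IHk].
  pose z : {ffun 'rV['F_2]_N -> 'F_2} := 0.
  apply: (@step 0%N 0%N); apply: (@leq_trans #|[set z]%SET|); last by rewrite cards1.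
  by apply/subset_leq_card/fintype.subsetP => f; rewrite !finset.inE.
apply: leq_trans (step _ _ IHk) _; rewrite leq_exp2l // expnS.
have : (0 < N.+1 ^ k)%N by rewrite expn_gt0.
nia.
Qed.

End DegLt.

(** * Biases, and the scarcity of strongly biased polynomials *)

Definition F2sign (R : realFieldType) (u : 'F_2) : R := if u == 0 then 1 else -1.

Definition bias (R : realFieldType) (N : nat) (f : {ffun 'rV['F_2]_N -> 'F_2}) : R :=
  (\sum_x F2sign R (f x)) / 2 ^+ N.

Section Bias.
Variables (R : realFieldType) (N : nat).
Implicit Types (f g : {ffun 'rV['F_2]_N -> 'F_2}).
Local Notation sg := (F2sign R).
Local Notation bias := (@bias R N).

Lemma F2signD u v : sg (u + v) = sg u * sg v.
Proof.
have e11 : (1 + 1 : 'F_2) = 0 by apply: val_inj.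
have [->|->] := F2_cases u; first by rewrite add0r /F2sign eqxx mul1r.
have [->|->] := F2_cases v; first by rewrite addr0 /F2sign eqxx mulr1.
by rewrite e11 /F2sign eqxx oner_eq0 mulrNN mulr1.
Qed.

Lemma F2signB u v : sg (u - v) = sg u * sg v.
Proof. by rewrite F2signD /F2sign oppr_eq0. Qed.

Lemma F2sign_sqr u : sg u ^+ 2 = 1.
Proof. by rewrite /F2sign; case: (u == 0); rewrite ?sqrrN expr1n. Qed.

Lemma F2sign_sum (I : Type) (r : seq I) (F : I -> 'F_2) :
  sg (\sum_(i <- r) F i) = \prod_(i <- r) sg (F i).
Proof.
elim: r => [|i r IHr]; first by rewrite !big_nil /F2sign eqxx.
by rewrite !big_cons F2signD IHr.
Qed.

Lemma sum_F2row_const (c : R) : \sum_(x : 'rV['F_2]_N) c = 2 ^+ N * c.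
Proof. by rewrite sumr_const card_F2row -natrX mulr_natl. Qed.

Lemma pow2N_gt0 : 0 < 2 ^+ N :> R.
Proof. exact: exprn_gt0. Qed.

Lemma sum_F2sign f : \sum_x sg (f x) = 2 ^+ N * bias f.
Proof. by rewrite /bias mulrC divfK // gt_eqF ?pow2N_gt0. Qed.

Lemma bias_support f :
  2 ^+ N * bias f = 2 ^+ N - 2 * #|[set x | f x != 0%R]%SET|%:R.
Proof.
rewrite -sum_F2sign -[X in X - _]mulr1 -sum_F2row_const.
rewrite -sum1dep_card natr_sum mulr_sumr [X in _ - X]big_mkcond -sumrB.
by apply: eq_bigr => x _; rewrite /F2sign; case: (f x == 0) => /=; lra.
Qed.

Lemma bias_zeros f :
  #|[set x | f x == 0%R]%SET|%:R = 2 ^+ N * ((1 + bias f) / 2) :> R.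
Proof.
have := bias_support f; have := congr1 (fun m => m%:R : R) (cardsC [set x | f x == 0]%SET).
rewrite natrD card_F2row natrX.
rewrite (_ : ~: _ = [set x | f x != 0])%SET; first by move=> e1 e2; nra.
by apply/setP => x; rewrite !finset.inE.
Qed.

Lemma bias_ge f : -1 <= bias f.
Proof.
have : 0 <= #|[set x | f x == 0%R]%SET|%:R :> R by [].
rewrite bias_zeros pmulr_rge0 ?pow2N_gt0 //; lra.
Qed.

Lemma bias_le1 f : bias f <= 1.
Proof.
rewrite -(ler_pM2l pow2N_gt0) bias_support mulr1.
have : 0 <= #|[set x | f x != 0%R]%SET|%:R :> R by [].
lra.
Qed.

Lemma bias_deg_lt (d : nat) f : f \in deg_lt N d.+1 -> f != 0 ->
  bias f <= 1 - 2 / 2 ^+ d.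
Proof.
move=> degf f0; have := weight_deg_lt degf f0.
rewrite -(ler_nat R) natrM !natrX => wt.
rewrite -(ler_pM2l pow2N_gt0) bias_support.
have d0 : 0 < 2 ^+ d :> R by apply: exprn_gt0.
rewrite mulrBr mulr1 lerD2l lerN2 mulrA ler_pdivrMr //.
by rewrite [X in X <= _]mulrC -mulrA ler_pM2l // mulrC.
Qed.

(** Second moment method: averaged over a, adding the shift by a to the list
    increases the left-hand side by at most 2^N on average, since the deviations
    g (x + a) - mu have mean zero over a. *)
Lemma exists_good_shifts (g : 'rV['F_2]_N -> R) (mu : R) (t : nat) :
    (forall x, g x ^+ 2 = 1) -> \sum_x g x = 2 ^+ N * mu ->
  exists s : {ffun 'I_t -> 'rV['F_2]_N},
    \sum_x (\sum_j (g (x + s j) - mu)) ^+ 2 <= t%:R * 2 ^+ N.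
Proof.
move=> g2 g_mean.
suff [s size_s sumS] : exists2 s : seq 'rV['F_2]_N, size s = t &
    \sum_x (\sum_(a <- s) (g (x + a) - mu)) ^+ 2 <= t%:R * 2 ^+ N.
  pose s_ := Tuple (introT eqP size_s).
  exists [ffun j => tnth s_ j].
  apply: le_trans sumS; apply: ler_sum => x _.
  rewrite -[s]/(tval s_) [in leRHS]big_tuple.
  by under eq_bigr do rewrite ffunE.
elim: t => [|t [s size_s IHs]].
  exists [::] => //; rewrite mul0r big1 // => x _.
  by rewrite big_nil expr0n.
pose S x := \sum_(a <- s) (g (x + a) - mu).
pose E a := \sum_x (g (x + a) - mu + S x) ^+ 2.
have shift_sum (F : 'rV['F_2]_N -> R) x : \sum_a F (x + a) = \sum_a F a.
  by rewrite [RHS](reindex_inj (addrI x)).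
have sumE : \sum_a E a <= 2 ^+ N * (t.+1%:R * 2 ^+ N).
  rewrite exchange_big /=.
  have inner x : \sum_a (g (x + a) - mu + S x) ^+ 2 <= 2 ^+ N + 2 ^+ N * S x ^+ 2.
    have -> : \sum_a (g (x + a) - mu + S x) ^+ 2 =
        \sum_a ((1 + mu ^+ 2 - 2 * S x * mu + S x ^+ 2) + (2 * S x - 2 * mu) * g (x + a)).
      by apply: eq_bigr => a _; have := g2 (x + a); nra.
    rewrite big_split /= sum_F2row_const -mulr_sumr shift_sum g_mean.
    have := pow2N_gt0; nra.
  apply: le_trans (ler_sum _ (fun x _ => inner x)) _.
  rewrite big_split /= sum_F2row_const -mulr_sumr -mulrDr ler_pM2l ?pow2N_gt0 //.
  by rewrite -[t.+1]addn1 natrD mulrDl mul1r addrC lerD2r.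
have [a Ea] : exists a, E a <= t.+1%:R * 2 ^+ N.
  apply: contrapT => noE; move: sumE; rewrite leNgt => /negP; apply.
  rewrite -sum_F2row_const; apply: ltr_sum.
    by apply/hasP; exists 0; rewrite ?mem_index_enum.
  move=> a _; rewrite ltNge; apply/negP => Ea; apply: noE; by exists a.
exists (a :: s); first by rewrite /= size_s.
by apply: le_trans Ea; apply: ler_sum => x _; rewrite big_cons.
Qed.

(** Multiplied by the sign of f x, the sum over j of the signs of the
    derivatives of f at x is the sum of the signs of f at the points x + s_j,
    which is close to t (bias f) in mean square over x.  Two functions that share the shifts
    and the derivatives are thus close to each other; biases above delta make
    every disagreement cost at least (2 t delta)^2, and the minimum distance
    excludes so few disagreements. *)
Lemma card_biased (d t : nat) (delta : R) : 0 < delta ->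
    2 ^+ d < t%:R * delta ^+ 2 ->
  (#|[set f in deg_lt N d.+1 | (delta < bias f)%R]%SET| <=
    (2 ^ N * #|deg_lt N d|) ^ t)%N.
Proof.
move=> delta0 td; set H := [set f in _ | _]%SET.
have choose_shifts f : exists s : {ffun 'I_t -> 'rV['F_2]_N},
    \sum_x (\sum_j (sg (f (x + s j)) - bias f)) ^+ 2 <= t%:R * 2 ^+ N.
  apply: (exists_good_shifts (g := fun x => sg (f x))) => [x|].
    exact: F2sign_sqr.
  exact: sum_F2sign.
pose sh f := projT1 (cid (choose_shifts f)).
pose key f := (sh f, [ffun j => fderiv (sh f j) f]).
pose G f x := \sum_j sg (fderiv (sh f j) f x).
have GP f : \sum_x (G f x - t%:R * bias f * sg (f x)) ^+ 2 <= t%:R * 2 ^+ N.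
  have := projT2 (cid (choose_shifts f)); rewrite -/(sh f).
  apply: le_trans; apply: ler_sum => x _.
  rewrite le_eqVlt; apply/orP; left; apply/eqP.
  transitivity ((sg (f x) * \sum_j (sg (f (x + sh f j)) - bias f)) ^+ 2).
    congr (_ ^+ 2); rewrite sumrB mulrBr sumr_const card_ord -[bias f *+ t]mulr_natl.
    rewrite [X in _ - X]mulrC; congr (_ - _); rewrite mulr_sumr.
    by apply: eq_bigr => j _; rewrite ffunE F2signB mulrC.
  by rewrite exprMn F2sign_sqr mul1r.
have key_inj : {in H &, injective key}.
  move=> f g; rewrite [f \in H]finset.in_set [g \in H]finset.in_set.
  move=> /andP[degf bf] /andP[degg bg] [shfg /ffunP Dfg].
  apply/eqP; apply: contraTT td => fg; rewrite -leNgt.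
  have Gfg x : G f x = G g x.
    have Dj j : fderiv (sh f j) f = fderiv (sh g j) g.
      by have := Dfg j; rewrite !ffunE.
    by apply: eq_bigr => j _; rewrite Dj.
  have fg0 : f - g != 0 by rewrite subr_eq0.
  have := weight_deg_lt (deg_ltB degf degg) fg0.
  set S := [set x | _]%SET; rewrite -(ler_nat R) natrM !natrX => wS.
  have S_bound : t%:R ^+ 2 * (2 * delta) ^+ 2 * #|S|%:R <= 4 * (t%:R * 2 ^+ N).
    apply: le_trans (_ : \sum_x (2 * (G f x - t%:R * bias f * sg (f x)) ^+ 2 +
      2 * (G g x - t%:R * bias g * sg (g x)) ^+ 2) <= _); last first.
      by rewrite big_split /= -!mulr_sumr; have := GP f; have := GP g; lra.
    rewrite mulr_natr -sumr_const [X in X <= _]big_mkcond.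
    apply: ler_sum => x _; rewrite finset.inE !ffunE subr_eq0.
    case: eqP => /= [_|/eqP fgx].
      by rewrite addr_ge0 // mulr_ge0 // sqr_ge0.
    have -> : sg (g x) = - sg (f x).
      move: fgx; have [->|->] := F2_cases (f x); have [->|->] := F2_cases (g x);
      by rewrite /F2sign ?eqxx ?oner_eq0 ?opprK.
    rewrite Gfg -exprMn.
    apply: le_trans (_ : (t%:R * (bias f + bias g)) ^+ 2 <= _).
      rewrite !exprMn ler_wpM2l ?sqr_ge0 // -exprMn lerXn2r ?nnegrE //; lra.
    have : (t%:R * (bias f + bias g)) ^+ 2 = (t%:R * (bias f + bias g) * sg (f x)) ^+ 2.
      by rewrite [RHS]exprMn F2sign_sqr mulr1.
    move=> ->.
    (* both u and v are small in mean square, and their difference is large *)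
    set u := G g x - _; set v := G g x - _.
    have -> : t%:R * (bias f + bias g) * sg (f x) = v - u by rewrite /u /v; ring.
    have := sqr_ge0 (u + v); nra.
  have N0 := pow2N_gt0; have d0 : 0 < 2 ^+ d :> R by apply: exprn_gt0.
  have S0 : 0 < #|S|%:R :> R.
    rewrite -(pmulr_rgt0 _ d0); exact: lt_le_trans wS.
  have [t0|t0] := eqVneq t 0%N; first by rewrite t0 mul0r ltW.
  have {}t0 : 0 < t%:R :> R by rewrite ltr0n lt0n.
  rewrite -(ler_pM2r S0) -(ler_pM2l t0).
  apply: le_trans (_ : t%:R * 2 ^+ N <= _); last by rewrite ler_pM2l.
  nra.
rewrite -(card_in_imset key_inj).
apply: (@leq_trans #|finset.setX [set: {ffun 'I_t -> 'rV['F_2]_N}]%SET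
   [set D : {ffun 'I_t -> _} | D \in ffun_on (deg_lt N d)]%SET|).
  apply: subset_leq_card; apply/fintype.subsetP => p /imsetP[f].
  rewrite finset.in_set => /andP[/deg_ltSP Df _] ->.
  by rewrite !finset.inE /=; apply/ffun_onP => i; rewrite ffunE.
by rewrite finset.cardsX cardsT card_ffun card_F2row cardsE card_ffun_on card_ord expnMn.
Qed.

End Bias.

(** * Moments of the bias of a random polynomial *)

Definition poly_fun (n d : nat) (c : 'rV['F_2]_(D n d)) :
    {ffun 'rV['F_2]_n.-1 -> 'F_2} :=
  [ffun x => (c *m Phi d x) 0 0].

Section PolyFun.
Variables (n d : nat).
Local Notation N := n.-1.
Implicit Types (c : 'rV['F_2]_(D n d)) (x : 'rV['F_2]_N).

Lemma poly_funE c x :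
  poly_fun c x = \sum_k c 0 k * \prod_(j in nth_small_set k) x 0 j.
Proof. by rewrite ffunE mxE; apply: eq_bigr => k _; rewrite mxE. Qed.

Lemma poly_funD c c' x : poly_fun (c + c') x = poly_fun c x + poly_fun c' x.
Proof. by rewrite !ffunE mulmxDl mxE. Qed.

Lemma poly_fun_deg_lt c : poly_fun c \in deg_lt N d.+1.
Proof.
rewrite (_ : poly_fun c = \sum_k
   [ffun x => c 0 k * [ffun x : 'rV_N => \prod_(j in nth_small_set k) x 0 j] x]).
  apply: deg_lt_sum => k; apply: deg_lt_scale.
  by apply: deg_lt_leq (deg_lt_monomial _); rewrite ltnS card_nth_small_set.
apply/ffunP => x; rewrite poly_funE sum_ffunE.
by apply: eq_bigr => k _; rewrite !ffunE.
Qed.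

(** Evaluating at the indicator of a set S isolates the coefficient of S once
    those of its proper subsets are known to vanish. *)
Lemma poly_fun_eq0 c : poly_fun c = 0 -> c = 0.
Proof.
move=> pc0; suff ck0 s (k : 'I_(D n d)) : (#|nth_small_set k| < s)%N -> c 0 k = 0.
  by apply/rowP => k; rewrite (ck0 _ k (ltnSn _)) mxE.
elim: s k => // s IHs k ks.
pose x : 'rV['F_2]_N := \row_j (j \in nth_small_set k)%:R.
have := congr1 (fun p : {ffun _ -> _} => p x) pc0; rewrite /= poly_funE ffunE => <-.
have sub_prod k' : \prod_(j in nth_small_set k') x 0 j =
    (nth_small_set k' \subset nth_small_set k)%:R.
  have [/fintype.subsetP sub|] := boolP (_ \subset _).
    by rewrite big1 // => j /sub jk; rewrite mxE jk.
  move=> /subsetPn[j jk' /negPf jk].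
  by rewrite (bigD1 j) //= mxE jk mul0r.
rewrite (bigD1 k) //= sub_prod subxx mulr1 big1 ?addr0 // => k' k'k.
rewrite sub_prod; have [sub|_] := boolP (_ \subset _); last by rewrite mulr0.
rewrite mulr1; apply: IHs; rewrite -ltnS; apply: leq_trans ks; rewrite ltnS.
apply: proper_card; rewrite finset.properEneq sub andbT.
by apply: contraNneq k'k => /nth_small_set_inj->.
Qed.

Lemma poly_fun_inj : injective (@poly_fun n d).
Proof.
move=> c c' pcc'; apply/subr0_eq/poly_fun_eq0/ffunP => x.
have oppc' : poly_fun (- c') x = - poly_fun c' x.
  by rewrite !ffunE mulNmx mxE.
by rewrite poly_funD oppc' pcc' subrr ffunE.
Qed.

Lemma exists_const_poly : exists c1, forall c x, poly_fun (c + c1) x = poly_fun c x + 1.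
Proof.
have [|k0 k0E] := @nth_small_set_surj n d finset.set0; first by rewrite cards0.
exists (delta_mx 0 k0) => c x; rewrite poly_funD; congr (_ + _).
rewrite poly_funE (bigD1 k0) //= mxE !eqxx mul1r k0E big_set0 big1 ?addr0 //.
by move=> k /negPf kk0; rewrite mxE kk0 andbF mul0r.
Qed.

End PolyFun.

Section Moments.
Variables (R : realFieldType).
Local Notation sg := (F2sign R).

Lemma sum_rows_prod (t N : nat) (g : 'rV['F_2]_N -> R) :
  (\sum_x g x) ^+ t = \sum_(Z : 'M['F_2]_(t, N)) \prod_i g (row i Z).
Proof.
elim: t => [|t IHt].
  rewrite expr0 (eq_bigr (fun=> 1)) => [|Z _]; last by rewrite big_ord0.
  by rewrite sumr_const card_F2mx.
rewrite exprSr IHt -[t.+1]/(1 + t)%N [RHS]sum_col_mx mulr_suml.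
apply: eq_bigr => Z _; rewrite mulr_sumr; apply: eq_bigr => v _.
rewrite big_split_ord big_ord1 /= rowKu row_id mulrC; congr (_ * _).
by apply: eq_bigr => i _; rewrite rowKd.
Qed.

Lemma sum_F2sign_char (K : nat) (v : 'cV['F_2]_K) :
  \sum_(c : 'rV['F_2]_K) sg ((c *m v) 0 0) = 2 ^+ K * (v == 0)%:R.
Proof.
have [->|v0] := eqVneq v 0.
  rewrite -sum_F2row_const; apply: eq_bigr => c _.
  by rewrite mulmx0 mxE /F2sign eqxx.
rewrite mulr0; have [k vk] : exists k, v k 0 = 1.
  have /existsP[k vk] : [exists k, v k 0 != 0].
    apply: contraNT v0 => /existsPn v0; apply/eqP/colP => k.
    by have := v0 k; rewrite negbK mxE => /eqP.
  by exists k; move: vk; have [->|->] := F2_cases (v k 0); rewrite ?eqxx.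
set S := \sum_c _; suff : S = - S by move=> SN; lra.
rewrite {1}/S (reindex_inj (addIr (delta_mx 0 k))) -sumrN; apply: eq_bigr => c _.
rewrite mulmxDl mxE F2signD -rowE [row _ _ _ _]mxE vk.
by rewrite {2}/F2sign oner_eq0 mulrN1.
Qed.

(** Expanding the power gives a sum over t-tuples of points of the sign of
    c times the sum of their columns, and averaging a character over c detects
    whether this sum is zero. *)
Lemma bias_moment (n d t : nat) :
  \sum_(c : 'rV['F_2]_(D n d)) bias R (poly_fun c) ^+ t =
  2 ^+ D n d * #|[set Z : 'M['F_2]_(t, n.-1) |
     \sum_i Phi d (row i Z) == 0]%SET|%:R / (2 ^+ n.-1) ^+ t.
Proof.
rewrite /bias; under eq_bigr do rewrite expr_div_n sum_rows_prod.
rewrite -mulr_suml; congr (_ / _); rewrite exchange_big /=.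
rewrite -sum1dep_card natr_sum [X in _ * X]big_mkcond mulr_sumr.
apply: eq_bigr => Z _.
rewrite (eq_bigr (fun c => sg ((c *m \sum_i Phi d (row i Z)) 0 0))) => [|c _].
  by rewrite sum_F2sign_char; case: eqP.
rewrite mulmx_sumr summxE F2sign_sum.
by apply: eq_bigr => i _; rewrite ffunE.
Qed.

(** Two columns cancel only if the points are equal: d >= 1 makes the
    coordinates themselves entries of the column. *)
Lemma bias_second_moment (n d : nat) : (1 <= d)%N ->
  \sum_(c : 'rV['F_2]_(D n d)) bias R (poly_fun c) ^+ 2 = 2 ^+ D n d / 2 ^+ n.-1.
Proof.
move=> d1; rewrite bias_moment.
set Q := [set Z | _]%SET.
pose pair (x : 'rV['F_2]_n.-1) : 'M['F_2]_(1 + 1, n.-1) := col_mx x x.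
have row_pair i x : row i (pair x) = x.
  by case: (split_ordP i) => i' ->; rewrite ?rowKu ?rowKd row_id.
have QE : Q = (pair @: [set: 'rV['F_2]_n.-1])%SET.
  apply/setP => Z; rewrite finset.in_set big_ord_recl big_ord1.
  apply/idP/imsetP => [|[x _ ->]]; last first.
    rewrite !row_pair.
    apply/eqP/colP => k; rewrite !mxE.
    by rewrite -[X in X + _]F2_oppr addNr.
  move=> /eqP/colP Z0; exists (row ord0 Z); first by rewrite finset.inE.
  have rowsE : row ord0 Z = row (lift ord0 ord0) Z.
    apply/rowP => j; have [|k kE] := @nth_small_set_surj n d [set j]%SET.
      by rewrite cards1.
    have := Z0 k; rewrite !mxE kE !big_set1 !mxE.
    by rewrite -[Z (lift _ _) _]F2_oppr => /subr0_eq->; rewrite F2_oppr.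
  apply/row_matrixP => i; rewrite row_pair.
  by case: (unliftP ord0 i) => [j|] -> //; rewrite ord1 rowsE.
have pair_inj : injective pair by move=> x y /eq_col_mx[].
rewrite QE card_imset // cardsT card_F2row natrX expr2 invfM mulrA mulrK //.
by rewrite unitfE gt_eqF // exprn_gt0.
Qed.

End Moments.

(** Double counting of the pairs of a tuple of points z and a polynomial that
    vanishes on it. *)
Lemma first_moment (R : realFieldType) (n d m : nat) :
  #|[set z : {ffun 'I_m -> 'rV['F_2]_n.-1} |
      (\rank (Phi_mx d z) < m)%N]%SET|%:R / (2 ^+ n.-1) ^+ m + 1 <=
  (\sum_(c : 'rV['F_2]_(D n d)) (1 + bias R (poly_fun c)) ^+ m) / 2 ^+ D n d.
Proof.
set N := n.-1; set K := D n d.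
pose vanish (z : {ffun 'I_m -> 'rV['F_2]_N}) :=
  [set c : 'rV['F_2]_K | c *m Phi_mx d z == 0%R]%SET.
have card_vanish z : #|vanish z| = (2 ^ (K - \rank (Phi_mx d z)))%N.
  rewrite -mxrank_ker -card_F2_rowg; apply: eq_card => c.
  by rewrite mem_rowg finset.in_set (sameP eqP sub_kermxP).
have vanishP z c : (c \in vanish z) = [forall i, poly_fun c (z i) == 0].
  rewrite finset.in_set; apply/eqP/forallP => [cz i|cz].
    rewrite ffunE; have /rowP/(_ i) := cz; rewrite !mxE => cz0.
    by apply/eqP; rewrite -[RHS]cz0; apply: eq_bigr => k _; rewrite !mxE.
  apply/rowP => i; have /eqP := cz i; rewrite ffunE !mxE => cz0.
  by rewrite -[RHS]cz0; apply: eq_bigr => k _; rewrite !mxE.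
have N0 : 0 < 2 ^+ N :> R by apply: exprn_gt0.
have lower : #|[set z : {ffun 'I_m -> 'rV['F_2]_N} |
      (\rank (Phi_mx d z) < m)%N]%SET|%:R + (2 ^+ N) ^+ m <=
    2 ^+ m / 2 ^+ K * \sum_z #|vanish z|%:R :> R.
  have -> : (2 ^+ N) ^+ m = \sum_(z : {ffun 'I_m -> 'rV['F_2]_N}) 1 :> R.
    by rewrite sumr_const card_ffun card_F2row card_ord -!natrX.
  rewrite -sum1dep_card natr_sum big_mkcond -big_split /= mulr_sumr.
  apply: ler_sum => z _; rewrite card_vanish mulrAC.
  set r := \rank _; have rm : (r <= m)%N := rank_leq_col _.
  have rK : (r <= K)%N := rank_leq_row _.
  rewrite ler_pdivlMr ?exprn_gt0 // natrX -exprD.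
  have [rm'|_] := boolP (r < m)%N.
    by rewrite -[1 + 1]/(2 ^+ 1) -exprD ler_weXn2l ?ler1n //; lia.
  by rewrite add0r mul1r ler_weXn2l ?ler1n //; lia.
have upper : \sum_z #|vanish z|%:R =
    \sum_(c : 'rV['F_2]_K) (2 ^+ N * ((1 + bias R (poly_fun c)) / 2)) ^+ m :> R.
  transitivity (\sum_(z : {ffun 'I_m -> 'rV['F_2]_N}) \sum_(c : 'rV['F_2]_K)
     \prod_(i : 'I_m) ((poly_fun c (z i) == 0) : nat)%:R : R).
    apply: eq_bigr => z _; rewrite -sum1_card natr_sum big_mkcond.
    apply: eq_bigr => c _; rewrite vanishP.
    have [/forallP cz|/forallPn[i czi]] := boolP [forall i, poly_fun c (z i) == 0].
      by rewrite big1 // => i _; rewrite cz.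
    by rewrite (bigD1 i) //= (negPf czi) mul0r.
  rewrite exchange_big /=; apply: eq_bigr => c _.
  rewrite -(bigA_distr_bigA (fun (_ : 'I_m) x => ((poly_fun c x == 0) : nat)%:R : R)).
  rewrite prodr_const card_ord -bias_zeros -sum1dep_card natr_sum [in RHS]big_mkcond.
  by congr (_ ^+ _); apply: eq_bigr => x _; case: eqP.
have Nm0 : 0 < (2 ^+ N) ^+ m :> R by apply: exprn_gt0.
rewrite -(ler_pM2r Nm0) mulrDl divfK ?gt_eqF // mul1r; apply: le_trans lower _.
rewrite upper mulrAC [X in _ <= X]mulrAC ler_pM2r ?invr_gt0 ?exprn_gt0 //.
rewrite mulr_sumr mulr_suml le_eqVlt; apply/orP; left; apply/eqP.
apply: eq_bigr => c _; rewrite -!exprMn; congr (_ ^+ _); by field.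
Qed.

(** * The failure probability in terms of biases *)

Lemma pow1D_quadratic (R : realFieldType) (x : R) (m : nat) :
  -1 <= x -> m%:R * `|x| <= 1 ->
  (1 + x) ^+ m <= 1 + m%:R * x + m%:R ^+ 2 * x ^+ 2.
Proof.
move=> x1; elim: m => [|m IHm] mx; first by rewrite expr0; lra.
have m0 : 0 <= m%:R :> R by [].
have mx1 : m%:R * `|x| <= 1.
  by apply: le_trans mx; rewrite ler_wpM2r // ler_nat.
have mxle : m%:R * x <= 1.
  by apply: le_trans mx1; rewrite ler_wpM2l // ler_norm.
rewrite exprSr; apply: le_trans (ler_wpM2r _ (IHm mx1)) _; first by lra.
have key : m%:R * x ^+ 2 * (m%:R * x) <= m%:R * x ^+ 2.
  by rewrite ler_piMr // mulr_ge0 // sqr_ge0.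
have := sqr_ge0 x; rewrite -[m.+1%:R]natr1; nra.
Qed.

Lemma two_sub_pow2_ge1 (R : realFieldType) (d : nat) : (1 <= d)%N ->
  1 <= 2 - 2 / 2 ^+ d :> R.
Proof.
move=> d_ge1; have : 2 / 2 ^+ d <= 1 :> R.
  rewrite ler_pdivrMr ?exprn_gt0 // mul1r -[X in X <= _]expr1.
  by rewrite ler_weXn2l ?ler1n.
lra.
Qed.

Section BiasSum.
Variables (R : realFieldType) (n d m : nat).
Hypotheses (d_ge1 : (1 <= d)%N) (m_ge1 : (1 <= m)%N) (m_le : (m <= D n d)%N).
Local Notation N := n.-1.
Local Notation K := (D n d).
Local Notation beta c := (bias R (poly_fun c)).

Definition biased (eps : R) : {set 'rV['F_2]_K} :=
  [set c | (eps < `|beta c|)%R]%SET.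

Definition biased_nonzero (delta : R) : {set 'rV['F_2]_K} :=
  [set c | (c != 0) && (delta < beta c)%R]%SET.

(** The shift of c that adds 1 to the polynomial negates the bias. *)
Lemma sum_small_bias_eq0 (eps : R) : \sum_(c in ~: biased eps) beta c = 0.
Proof.
have [c1 c1E] := exists_const_poly n d.
have negb c : beta (c + c1) = - beta c.
  rewrite /bias -mulNr -sumrN; congr (_ / _); apply: eq_bigr => x _.
  by rewrite c1E F2signD /F2sign oner_eq0 mulrN1.
set S := LHS; suff : S = - S by move=> SN; lra.
rewrite {1}/S (reindex_inj (addIr c1)) -sumrN.
by apply: eq_big => [c|c _]; rewrite ?finset.inE negb // normrN.
Qed.

Lemma sum_bias_split (delta : R) : 0 <= delta ->
  \sum_(c : 'rV['F_2]_K) (1 + beta c) ^+ m <=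
  2 ^+ m + 2 ^+ K * (1 + m%:R ^+ 2 / 2 ^+ N) +
  #|biased K%:R^-1|%:R * (1 + delta) ^+ m +
  #|biased_nonzero delta|%:R * (2 - 2 / 2 ^+ d) ^+ m.
Proof.
move=> delta0; set W := biased _; set H := biased_nonzero _.
have K0 : 0 < K%:R :> R by rewrite ltr0n (leq_trans m_ge1).
have two_d := two_sub_pow2_ge1 R d_ge1.
have two_dm : 0 <= (2 - 2 / 2 ^+ d) ^+ m :> R by rewrite exprn_ge0 //; lra.
have delta_m : 0 <= (1 + delta) ^+ m by rewrite exprn_ge0 //; lra.
pose q (c : 'rV['F_2]_K) := 1 + m%:R * beta c + m%:R ^+ 2 * beta c ^+ 2.
have q_ge0 c : 0 <= q c.
  by rewrite /q; have := sqr_ge0 (1 + m%:R * beta c); have := sqr_ge0 (m%:R * beta c); nra.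
(* c = 0; small bias; large bias, at most delta; bias above delta *)
have pointwise c : (1 + beta c) ^+ m <= (if c == 0 then 2 ^+ m else 0) +
    (if c \in ~: W then q c else 0) + (if c \in W then (1 + delta) ^+ m else 0) +
    (if c \in H then (2 - 2 / 2 ^+ d) ^+ m else 0).
  have b1 := bias_ge R (poly_fun c); have b2 := bias_le1 R (poly_fun c).
  rewrite !finset.inE; have [c0|c0] /= := eqVneq c 0.
    apply: le_trans (_ : 2 ^+ m <= _).
      by rewrite lerXn2r ?nnegrE //; lra.
    have := q_ge0 c; case: ifP => _; case: ifP => _; lra.
  have [bd|bd] := ltP delta (beta c).
    apply: le_trans (_ : (2 - 2 / 2 ^+ d) ^+ m <= _).
      rewrite lerXn2r ?nnegrE //; try lra.
      have pc0 : poly_fun c != 0 by apply: contraNneq c0 => /poly_fun_eq0->.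
      have := bias_deg_lt R (poly_fun_deg_lt c) pc0; lra.
    have := q_ge0 c; case: ifP => _; case: ifP => _; lra.
  have [bW|bW] := ltP K%:R^-1 `|beta c|.
    rewrite add0r addr0 add0r lerXn2r ?nnegrE //; lra.
  rewrite add0r !addr0; apply: pow1D_quadratic => //.
  apply: le_trans (_ : K%:R * `|beta c| <= _).
    by rewrite ler_wpM2r // ler_nat.
  by rewrite mulrC -ler_pdivlMr // mul1r.
apply: le_trans (ler_sum _ (fun c _ => pointwise c)) _.
have sum_ind (A : {set 'rV['F_2]_K}) (x : R) :
    \sum_c (if c \in A then x else 0) = #|A|%:R * x.
  by rewrite -big_mkcond sumr_const mulr_natl.
rewrite !big_split /= !sum_ind -[X in X + _ + _ + _ <= _]big_mkcond big_pred1_eq.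
rewrite !lerD2r lerD2l -[X in X <= _]big_mkcond /= /q !big_split /= -!mulr_sumr.
rewrite sum_small_bias_eq0 mulr0 addr0.
rewrite mulrDr mulr1; apply: lerD.
  rewrite sumr_const -natrX -card_F2row ler_nat.
  exact: max_card.
rewrite mulrCA ler_wpM2l ?sqr_ge0 // -(bias_second_moment R n d_ge1).
rewrite big_mkcond; apply: ler_sum => c _; case: ifP => // _; exact: sqr_ge0.
Qed.

End BiasSum.

(** Markov inequality for the moment of order 2 h^k. *)
Lemma card_biased_le (R : realFieldType) (n k h : nat) :
    (0 < h)%N -> (h.*2 * k.+1 <= n.-1)%N -> (0 < D n k.+1)%N ->
  #|biased n k.+1 ((D n k.+1)%:R^-1 : R)|%:R <=
    2 ^+ D n k.+1 * ((D n k.+1)%:R ^+ 2 * k.+1%:R / 2 ^+ h) ^+ (h ^ k) :> R.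
Proof.
move=> h0 hN K0; set K := D n k.+1; set s := (h ^ k)%N.
have Kr0 : 0 < K%:R :> R by rewrite ltr0n.
have moment := bias_moment R n k.+1 (s + s); have := card_Phi_sum_eq0 h0 hN.
rewrite -/s; set Q := #|_| => cardQ.
have N0 : 0 < 2 ^+ n.-1 :> R by apply: exprn_gt0.
have moment_le : \sum_(c : 'rV['F_2]_K) bias R (poly_fun c) ^+ (s + s) <=
    2 ^+ K * (k.+1%:R / 2 ^+ h) ^+ s.
  rewrite moment -/K -mulrA ler_pM2l ?exprn_gt0 // ler_pdivrMr ?exprn_gt0 //.
  rewrite expr_div_n -exprM mulrAC ler_pdivlMr ?exprn_gt0 //.
  rewrite -!natrX -!natrM ler_nat -[((2 ^ h) ^ s)%N]expnM.
  by rewrite [X in (_ <= X)%N]mulnC [(2 ^ (n.-1 * _))%N]expnM.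
rewrite -[_ ^+ 2 * _ / _]mulrA [X in _ <= _ * X]exprMn -exprM mul2n -addnn mulrCA.
apply: le_trans (_ : K%:R ^+ (s + s) *
  (\sum_(c : 'rV['F_2]_K) bias R (poly_fun c) ^+ (s + s)) <= _).
  rewrite mulr_sumr -sumr_const; set W := biased _ _ _.
  rewrite big_mkcond; apply: ler_sum => c _.
  rewrite -exprMn addnn -mul2n exprM; case: ifP => [|_]; last by rewrite exprn_ge0 // sqr_ge0.
  rewrite finset.inE => bc; apply: exprn_ege1; rewrite -[X in _ <= X]real_normK ?num_real //.
  apply: exprn_ege1; rewrite normrM (ger0_norm (ltW Kr0)).
  by rewrite mulrC -ler_pdivrMr // mul1r ltW.
by rewrite ler_pM2l ?exprn_gt0.
Qed.

(** For k = 0 the polynomials are affine, and the nonzero ones have bias at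
    most 0. *)
Lemma card_biased_nonzero_le (R : realFieldType) (n k t : nat) (delta : R) :
    0 < delta -> 2 ^+ k.+1 < t%:R * delta ^+ 2 ->
  (#|biased_nonzero n k.+1 delta| <=
    if k == 0%N then 0 else (2 ^ n.-1 * 2 ^ (n.-1.+1 ^ k)) ^ t)%N.
Proof.
move=> delta0 td; case: eqP => [k0|/eqP k0].
  rewrite leqn0 cards_eq0; apply/eqP/setP => c; rewrite !finset.inE.
  apply/negP => /andP[c0]; apply/negP; rewrite -leNgt.
  have pc0 : poly_fun c != 0 by apply: contraNneq c0 => /poly_fun_eq0->.
  apply: le_trans (bias_deg_lt R (poly_fun_deg_lt c) pc0) _.
  by rewrite k0 expr1; lra.
rewrite -(card_imset _ (@poly_fun_inj n k.+1)).
apply: leq_trans (_ : #|[set f in deg_lt n.-1 k.+2 | (delta < bias R f)%R]%SET| <= _)%N.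
  apply: subset_leq_card; apply/fintype.subsetP => f /imsetP[c].
  rewrite finset.in_set => /andP[_ bc] ->; rewrite finset.in_set bc andbT.
  exact: poly_fun_deg_lt.
apply: leq_trans (card_biased _ delta0 td) _.
have le_pow a b : (a <= b -> a ^ t <= b ^ t)%N.
  by elim: t {td} => // t IHt ab; rewrite !expnS leq_mul ?IHt.
by apply: le_pow; rewrite leq_mul2l card_deg_lt orbT.
Qed.

Lemma bad_fraction_le (R : realFieldType) (n k m h t : nat) (delta : R) :
    (1 <= m <= D n k.+1)%N -> (0 < h)%N -> (h.*2 * k.+1 <= n.-1)%N ->
    0 < delta -> 2 ^+ k.+1 < t%:R * delta ^+ 2 ->
  #|[set z : {ffun 'I_m -> 'rV['F_2]_n.-1} |
      (\rank (Phi_mx k.+1 z) < m)%N]%SET|%:R / (2 ^+ n.-1) ^+ m <=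
  2 ^- (D n k.+1 - m) + m%:R ^+ 2 / 2 ^+ n.-1 +
  (((D n k.+1)%:R ^+ 2 * k.+1%:R / 2 ^+ h) ^+ (h ^ k) * (1 + delta) ^+ D n k.+1 +
   (if k == 0%N then 0 else (2 ^ n.-1 * 2 ^ (n.-1.+1 ^ k)) ^ t)%N%:R *
     (1 - 1 / 2 ^+ k.+1) ^+ D n k.+1).
Proof.
move=> /andP[m1 mK] h0 hN delta0 td.
set K := D n k.+1 in mK *; set Hb := (X in X%:R * (1 - _) ^+ _).
have K0 : (0 < K)%N by apply: leq_trans mK.
have := first_moment R n k.+1 m; rewrite -/K; set bad := _ / _ => fm.
have split := sum_bias_split (isT : (1 <= k.+1)%N) m1 mK (ltW delta0).
have cW := card_biased_le R h0 hN K0.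
have cH := card_biased_nonzero_le n delta0 td.
rewrite -/K -/Hb in split cW cH; rewrite -(ler_nat R) in cH.
set eW := _ ^+ (h ^ k) in cW *.
have two_d := two_sub_pow2_ge1 R (isT : (1 <= k.+1)%N).
have p2K : 0 < 2 ^+ K :> R by apply: exprn_gt0.
rewrite -(lerD2r 1); apply: le_trans fm _; rewrite ler_pdivrMr //.
apply: le_trans split _.
have e1 : 2 ^- (K - m) * 2 ^+ K = 2 ^+ m :> R.
  by rewrite -{2}(subnKC mK) exprD mulrCA mulVf ?mulr1 // gt_eqF // exprn_gt0.
have e2 : (1 - 1 / 2 ^+ k.+1) ^+ K * 2 ^+ K = (2 - 2 / 2 ^+ k.+1) ^+ K :> R.
  by rewrite -exprMn; congr (_ ^+ _); rewrite mulrBl !mul1r [X in _ - X = _]mulrC.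
have -> : (2 ^- (K - m) + m%:R ^+ 2 / 2 ^+ n.-1 + (eW * (1 + delta) ^+ K +
    Hb%:R * (1 - 1 / 2 ^+ k.+1) ^+ K) + 1) * 2 ^+ K =
  2 ^- (K - m) * 2 ^+ K + 2 ^+ K * (1 + m%:R ^+ 2 / 2 ^+ n.-1) +
  2 ^+ K * eW * (1 + delta) ^+ K +
  Hb%:R * ((1 - 1 / 2 ^+ k.+1) ^+ K * 2 ^+ K) :> R by ring.
rewrite e1 e2; apply: lerD; first apply: lerD => //.
  apply: ler_pM => //; first by rewrite exprn_ge0 //; lra.
  by rewrite ler_weXn2l //; lra.
apply: ler_pM => //; first by rewrite exprn_ge0 //; lra.
by rewrite ler_weXn2l //; lra.
Qed.

(** * Choice of the constants *)

Lemma D_le_pow (n d : nat) : (D n d <= n.-1.+1 ^ d)%N.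
Proof.
have bin_le N k : ('C(N, k) <= N ^ k)%N.
  apply: (@leq_trans (N ^_ k)); first by rewrite -bin_ffact leq_pmulr ?fact_gt0.
  rewrite ffact_prod -[X in (_ <= _ ^ X)%N](card_ord k) -prod_nat_const.
  by apply: leq_prod => i _; rewrite leq_subr.
elim: d => [|d IHd]; first by rewrite /D big_nat1 bin0.
rewrite /D big_nat_recr //= -/(D n d) expnS mulSn leq_add //.
apply: leq_trans (bin_le _ _) _; rewrite expnS leq_mul2l; apply/orP; right.
by elim: (d) => // e IHe; rewrite !expnS leq_mul.
Qed.

Lemma pow_le_D (n d h : nat) : (0 < h)%N -> (h.*2 * d <= n.-1)%N ->
  (h ^ d <= D n d)%N.
Proof.
move=> h0 hN; apply: (@leq_trans 'C(n.-1, d)).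
  rewrite -(leq_pmul2r (fact_gt0 d)) bin_ffact ffact_prod fact_prod.
  rewrite -[X in (_ ^ X)%N](card_ord d) -prod_nat_const.
  rewrite big_add1 big_mkord -big_split /= (reindex_inj rev_ord_inj) /=.
  apply: leq_prod => i _.
  have id := ltn_ord i; nia.
by rewrite /D big_nat_recr //= leq_addl.
Qed.

Section Asymptotics.
Variable R : realType.

Lemma ln2_gt0 : 0 < ln 2 :> R.
Proof. by rewrite ln_gt0 // ltr1n. Qed.

Lemma pow2_expR (p : nat) : 2 ^+ p = expR (p%:R * ln 2) :> R.
Proof. by rewrite expRM_natl lnK // posrE. Qed.

Lemma eventually_pow_le_expR (A a : R) (p : nat) : 0 < a ->
  exists h0 : nat, forall h : nat, (h0 <= h)%N -> A * h%:R ^+ p <= expR (a * h%:R).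
Proof.
move=> a0; pose b := a ^+ p.+1 / p.+1`!%:R.
have b0 : 0 < b by rewrite divr_gt0 ?exprn_gt0 // ltr0n fact_gt0.
exists (Num.bound `|A / b|) => h hb.
have Ah : A <= b * h%:R.
  rewrite mulrC -ler_pdivrMr //; apply: le_trans (ler_norm _) _.
  by apply: ltW; apply: lt_le_trans (archi_boundP (normr_ge0 _)) _; rewrite ler_nat.
have ah0 : 0 <= a * h%:R by rewrite mulr_ge0 // ltW.
apply: le_trans (expR_ge1Dxn p ah0); apply: le_trans (_ : b * h%:R ^+ p.+1 <= _).
  by rewrite exprS mulrA ler_wpM2r ?exprn_ge0.
by rewrite exprMn mulrAC lerDr.
Qed.

(** With h = N / (2 d), both D and N^d are between constant multiples of h^d.
    The constant delta is chosen first, so small that (1 + delta)^D loses only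
    half of the gain 2^(-h^d/2) of the tail bound; then t is a constant, and the
    number of strongly biased polynomials is 2^(O(h^k)), which is negligible
    against (1 - 2^-d)^D <= e^(-2^-d h^d). *)
Lemma remainder_asymptotics (k : nat) :
  exists delta c : R, exists t n0 : nat, [/\ 0 < delta, 0 < c,
    2 ^+ k.+1 < t%:R * delta ^+ 2 &
    forall n, (n0 <= n)%N -> exists h : nat, [/\ (0 < h)%N,
      (h.*2 * k.+1 <= n.-1)%N &
      ((D n k.+1)%:R ^+ 2 * k.+1%:R / 2 ^+ h) ^+ (h ^ k) * (1 + delta) ^+ D n k.+1 +
      (if k == 0%N then 0 else (2 ^ n.-1 * 2 ^ (n.-1.+1 ^ k)) ^ t)%N%:R *
        (1 - 1 / 2 ^+ k.+1) ^+ D n k.+1 <= expR (- (c * n.-1%:R ^+ k.+1))]].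
Proof.
have arith (x y z : R) : x <= y -> z <= y -> x - 2 * y <= - z by move=> *; lra.
set d := k.+1; pose l : R := ln 2; have l0 : 0 < l := ln2_gt0.
pose M : R := (4 * d%:R) ^+ d.
have M0 : 0 < M by rewrite exprn_gt0 // mulr_gt0.
pose delta : R := l / (4 * M).
have delta0 : 0 < delta by rewrite divr_gt0 // mulr_gt0.
pose t := Num.bound (2 ^+ d / delta ^+ 2).
have td : 2 ^+ d < t%:R * delta ^+ 2.
  rewrite -ltr_pdivrMr ?exprn_gt0 //.
  by apply: archi_boundP; rewrite divr_ge0 // exprn_ge0 // ltW.
pose e : R := 2^-1 / 2 ^+ d.
have e0 : 0 < e by rewrite divr_gt0 // exprn_gt0.
have e2 : 1 / 2 ^+ d = 2 * e by rewrite /e mulrA divff.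
have e2_le1 : 2 * e <= 1.
  rewrite -e2 ler_pdivrMr ?exprn_gt0 // mul1r -[X in X <= _](expr1n _ d).
  by rewrite lerXn2r ?nnegrE ?ler1n.
clearbody e.
pose c1 : R := Num.min (l / 4) e.
have c10 : 0 < c1 by rewrite lt_min e0 divr_gt0.
have l2 : 0 < l / 2 by rewrite divr_gt0.
have c12 : 0 <= c1 / 2 by rewrite divr_ge0 // ltW.
have [h1 h1P] := eventually_pow_le_expR (M ^+ 2 * d%:R) (2 * d) l2.
pose A : R := l * t%:R * 2 * (4 * d%:R) ^+ k.
pose h2 := Num.bound (A / e).
pose h3 := Num.bound (2 / c1).
pose hmin := maxn 1 (maxn h1 (maxn h2 h3)).
exists delta, (c1 / 2 / M), t, (hmin * (2 * d)).+1; split=> //.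
  by rewrite !divr_gt0.
move=> n nlarge; pose h := (n.-1 %/ (2 * d))%N.
have nmin : (hmin * (2 * d) <= n.-1)%N by case: (n) nlarge.
have hlarge : (hmin <= h)%N by rewrite leq_divRL.
have {hlarge} [h0 hh1 hh2 hh3] : [/\ 0 < h, h1 <= h, h2 <= h & h3 <= h]%N.
  by move: hlarge; rewrite !geq_max => /and4P[].
have hN : (h.*2 * d <= n.-1)%N.
  by rewrite -mul2n mulnAC mulnC; apply: leq_divM.
have Nh : (n.-1.+1 <= 4 * d * h)%N.
  have : (n.-1 < h.+1 * (2 * d))%N by rewrite ltn_ceil.
  have : (d <= d * h)%N by rewrite leq_pmulr.
  lia.
exists h; split=> //.
set K := D n d; set N := n.-1 in hN Nh *.
have NhR j : N.+1%:R ^+ j <= (4 * d%:R) ^+ j * h%:R ^+ j :> R.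
  rewrite -exprMn lerXn2r ?nnegrE ?mulr_ge0 //.
  by rewrite -[4]/(4%:R) -!natrM ler_nat.
have Kup : K%:R <= M * h%:R ^+ d :> R.
  apply: le_trans (NhR d); rewrite -natrX ler_nat; exact: D_le_pow.
have Klow : h%:R ^+ d <= K%:R :> R.
  by rewrite -natrX ler_nat; apply: pow_le_D.
set H := h%:R ^+ d in Kup Klow.
have hd_ge (x : R) : x <= h%:R -> x <= H.
  move=> xh; apply: le_trans xh _; rewrite -[X in X <= _]expr1 ler_weXn2l //.
  by rewrite ler1n.
have hR1 : 1 <= h%:R :> R by rewrite ler1n.
have bound_le (x : R) : (Num.bound x <= h)%N -> 0 <= x -> x <= h%:R.
  move=> xh x0; apply: ltW; apply: lt_le_trans (archi_boundP x0) _.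
  by rewrite ler_nat.
have term1 : (K%:R ^+ 2 * d%:R / 2 ^+ h) ^+ (h ^ k) * (1 + delta) ^+ K <=
    expR (- (c1 * H)).
  have base : K%:R ^+ 2 * d%:R / 2 ^+ h <= expR (- (l / 2 * h%:R)).
    rewrite ler_pdivrMr ?exprn_gt0 // pow2_expR -expRD -/l.
    have -> : - (l / 2 * h%:R) + h%:R * l = l / 2 * h%:R by field.
    apply: le_trans (h1P h hh1); rewrite [X in _ <= X]mulrAC ler_wpM2r //.
    rewrite mulnC exprM -exprMn lerXn2r ?nnegrE ?mulr_ge0 ?exprn_ge0 //; exact: ltW.
  have pow1 : (K%:R ^+ 2 * d%:R / 2 ^+ h) ^+ (h ^ k) <= expR (- (l / 2 * H)).
    have -> : - (l / 2 * H) = - (l / 2 * h%:R) * (h ^ k)%:R.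
      by rewrite natrX mulNr /H exprS mulrA.
    rewrite expRM_natr lerXn2r ?nnegrE ?expR_ge0 //.
  have pow2 : (1 + delta) ^+ K <= expR (l / 4 * H).
    apply: le_trans (_ : expR (delta * K%:R) <= _).
      rewrite expRM_natr lerXn2r ?nnegrE ?expR_ge0 ?expR_ge1Dx //.
      by rewrite addr_ge0 // ltW.
    rewrite ler_expR; apply: le_trans (ler_wpM2l (ltW delta0) Kup) _.
    by rewrite /delta le_eqVlt; apply/orP; left; apply/eqP; field; rewrite gt_eqF.
  apply: le_trans (ler_pM _ _ pow1 pow2) _; rewrite ?exprn_ge0 //;
    first by rewrite addr_ge0 // ltW.
  rewrite -expRD ler_expR.
  have : c1 * H <= l / 4 * H by rewrite ler_wpM2r ?exprn_ge0 // ge_min lexx.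
  lra.
have term2 : (if k == 0%N then 0 else (2 ^ N * 2 ^ (N.+1 ^ k)) ^ t)%N%:R *
    (1 - 1 / 2 ^+ d) ^+ K <= expR (- (c1 * H)).
  have [_|k0] := eqVneq k 0%N; first by rewrite mul0r expR_ge0.
  have count_le : ((2 ^ N * 2 ^ (N.+1 ^ k)) ^ t)%N%:R <= expR (A * h%:R ^+ k).
    rewrite -expnD -expnM natrX pow2_expR ler_expR -/l.
    apply: le_trans (_ : (2 * N.+1 ^ k * t)%N%:R * l <= _).
      rewrite ler_wpM2r ?(ltW l0) // ler_nat leq_mul2r mul2n -addnn leq_add2r.
      apply/orP; right; apply: leq_trans (leqnSn _) _.
      by rewrite -[X in (X <= _)%N]expn1 leq_pexp2l // lt0n.
    have lt0 : 0 <= l * t%:R * 2 by rewrite !mulr_ge0 // ltW.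
    have := ler_wpM2l lt0 (NhR k); rewrite !natrM natrX /A.
    rewrite -[_ * _ * _ * _ * _ ^+ _]mulrA; apply: le_trans.
    by rewrite le_eqVlt; apply/orP; left; apply/eqP; ring.
  have pow_le : (1 - 1 / 2 ^+ d) ^+ K <= expR (- (2 * e * H)).
    rewrite e2; apply: le_trans (_ : expR (- (2 * e) * K%:R) <= _).
      by rewrite expRM_natr lerXn2r ?nnegrE ?expR_ge0 ?expR_ge1Dx // subr_ge0.
    by rewrite ler_expR mulNr lerN2 ler_wpM2l // mulr_ge0 // ltW.
  apply: le_trans (ler_pM _ _ count_le pow_le) _; rewrite ?exprn_ge0 // ?e2 ?subr_ge0 //.
  rewrite -expRD ler_expR.
  have A0 : 0 <= A by rewrite /A !mulr_ge0 ?exprn_ge0 ?mulr_ge0 // ltW.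
  have AeH : A * h%:R ^+ k <= e * H.
    rewrite /H exprS mulrA ler_wpM2r ?exprn_ge0 // mulrC -ler_pdivrMr //.
    by apply: bound_le; rewrite // divr_ge0 // ltW.
  rewrite -mulrA; apply: arith AeH _.
  by rewrite ler_wpM2r ?exprn_ge0 // ge_min lexx orbT.
apply: le_trans (lerD term1 term2) _.
have two_le : 2 <= expR 1 :> R by have := expR_ge1Dx (1 : R); lra.
have c1H : 2 <= c1 * H.
  by rewrite mulrC -ler_pdivrMr //; apply/hd_ge/bound_le; rewrite // divr_ge0 // ltW.
apply: le_trans (_ : expR 1 * expR (- (c1 * H)) <= _).
  have := expR_ge0 (- (c1 * H)); nra.
rewrite -expRD ler_expR.
have NH : N%:R ^+ d <= M * H.
  by apply: le_trans (NhR d); rewrite lerXn2r ?nnegrE ?ler_nat.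
have : c1 / 2 / M * N%:R ^+ d <= c1 / 2 * H.
  rewrite mulrAC ler_pdivrMr // -[X in _ <= X]mulrA [H * M]mulrC.
  by rewrite ler_wpM2l.
lra.
Qed.

End Asymptotics.

(** * The bound for uniform points *)

Lemma bad_fraction_rank_bound (R : realType) (d : nat) : (1 <= d)%N ->
  exists c : R, exists n0 : nat, 0 < c /\
  forall n m : nat, (n0 <= n)%N -> (1 <= m <= D n d)%N ->
  #|[set z : {ffun 'I_m -> 'rV['F_2]_n.-1} |
      (\rank (Phi_mx d z) < m)%N]%SET|%:R / (2 ^+ n.-1) ^+ m <=
  rank_bound 1 c n d m.
Proof.
case: d => // k _; have [delta [c [t [n0 [delta0 c0 td asym]]]]] := remainder_asymptotics R k.
exists c, n0; split=> // n m /asym[h [h0 hN remainder]] m_bounds.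
have N0 : 0 < (2 ^+ n.-1) ^+ m :> R by rewrite !exprn_gt0.
set bad := _ / _; have bad1 : bad <= 1.
  rewrite ler_pdivrMr // mul1r -!natrX ler_nat.
  have := max_card (mem [set z : {ffun 'I_m -> 'rV['F_2]_n.-1} |
      (\rank (Phi_mx k.+1 z) < m)%N]%SET).
  by rewrite card_ffun card_F2row card_ord.
have := bad_fraction_le m_bounds h0 hN delta0 td; rewrite -/bad => bad_le.
rewrite /rank_bound mul1r.
pose x : R := 2 `^ (- (n.-1%:R / 2)); rewrite -/x.
have x0 : 0 < x by apply: powR_gt0.
have x2 : (2 ^+ n.-1)^-1 = x ^+ 2 :> R.
  rewrite -powR_mulrn ?(ltW x0) // -powRrM mulNr divfK // powRN.
  by rewrite powR_mulrn.
have p0 : 0 <= 2 ^- (D n k.+1 - m) :> R by rewrite invr_ge0 exprn_ge0.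
(* when m 2^(-N/2) > 1, the right-hand side exceeds 1 *)
have [mx|mx] := leP (m%:R * x) 1; last first.
  have := expR_ge0 (- (c * n.-1%:R ^+ k.+1)); lra.
apply: le_trans bad_le _; apply: lerD remainder; rewrite lerD2l x2 -exprMn.
by rewrite expr2 ler_piMr // mulr_ge0 // ltW.
Qed.

Section RealRank.
Variable R : realType.

Lemma card_pm1 : #|{: pm1 R}| = 2%N.
Proof.
rewrite card_seq_sub //= andbT inE -subr_eq0 opprK.
by rewrite -[1 + 1]/(2%:R) pnatr_eq0.
Qed.

Definition pm1_bit (y : pm1 R) : bool := val y == -1.

Lemma val_pm1 (y : pm1 R) : val y = 1 - 2 * (pm1_bit y)%:R.
Proof.
have := valP y; rewrite /pm1_bit !inE => /orP[/eqP->|/eqP->].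
  rewrite -subr_eq0 opprK -[1 + 1]/(2%:R) pnatr_eq0 /=; lra.
by rewrite eqxx /=; lra.
Qed.

Lemma pm1_bit_inj : injective pm1_bit.
Proof. by move=> y y' yy'; apply: val_inj; rewrite /= !val_pm1 yy'. Qed.

Lemma sum_nth_small_set (n d : nat) (h : {set 'I_n.-1} -> R) :
  \sum_k h (@nth_small_set n d k) = \sum_(J in small_sets n d) h J.
Proof.
rewrite [RHS]big_enum_val /=.
rewrite (reindex (cast_ord (card_small_sets n d))) /=; last first.
  by apply: onW_bij; apply: (Bijective (cast_ordK _) (cast_ordKV _)).
by apply: eq_bigr => i _; rewrite /nth_small_set cast_ordK.
Qed.

Section OneMatrix.
Variables (n d m : nat) (y : 'I_m -> 'rV[pm1 R]_n.-1).
Local Notation N := n.-1.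

Definition bit_row (v : 'rV[pm1 R]_N) : 'rV['F_2]_N :=
  \row_j (pm1_bit (v 0 j))%:R.

Definition int_Phi_mx : 'M[int]_(D n d, m) :=
  \matrix_(k, i) \prod_(j in nth_small_set k) (pm1_bit (y i 0 j))%:R.

Lemma int_Phi_mx_mod2 :
  map_mx intr int_Phi_mx = Phi_mx d (fun i => bit_row (y i)).
Proof.
apply/matrixP => k i; rewrite !mxE rmorph_prod; apply: eq_bigr => j _.
by rewrite mxE rmorph_nat.
Qed.

(** The coefficients in the expansion of the product over S of (1 - y_i) / 2
    into characters.  Characters on sets not contained in S get coefficient 0,
    which is why degree at most d is preserved. *)
Definition bit_to_chi : 'M[R]_(D n d) :=
  \matrix_(k', k) \prod_i
    (if i \in nth_small_set k' then
       if i \in nth_small_set k then - 2^-1 else 0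
     else if i \in nth_small_set k then 2^-1 else 1).

Lemma int_Phi_mx_chi :
  (map_mx intr int_Phi_mx)^T = chi_mx d y *m bit_to_chi :> 'M[R]_(m, D n d).
Proof.
apply/matrixP => i k; rewrite !mxE rmorph_prod /=; set S := nth_small_set k.
pose F j : R := if j \in S then - 2^-1 * val (y i 0 j) else 0.
pose G (j : 'I_N) : R := if j \in S then 2^-1 else 1.
transitivity (\prod_j (F j + G j)).
  rewrite big_mkcond; apply: eq_bigr => j _; rewrite /F /G.
  case: ifP => _; last by rewrite add0r.
  by rewrite rmorph_nat val_pm1; field.
rewrite bigA_distr /= (bigID (mem (small_sets n d))) /= [X in _ + X]big1 ?addr0.
  rewrite -sum_nth_small_set; apply: eq_bigr => k' _; rewrite !mxE /chi.
  rewrite [X in _ = X * _]big_mkcond -big_split; apply: eq_bigr => j _ /=.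
  rewrite /F /G; case: ifP => _; case: ifP => _; rewrite ?mulr0 ?mul1r //.
  by rewrite mulrC.
move=> J; rewrite finset.in_set -ltnNge => Jd.
have /subsetPn[j jJ jS] : ~~ (J \subset S).
  apply: contraL Jd => /subset_leq_card JS.
  by rewrite -leqNgt (leq_trans JS) ?card_nth_small_set.
by rewrite (bigD1 j) //= jJ /F (negPf jS) mul0r.
Qed.

(** A minor of the binary matrix of order m lifts to an integer minor that is
    nonzero modulo 2, hence nonzero over R. *)
Lemma rank_Phi_le_chi : (\rank (chi_mx d y) < m)%N ->
  (\rank (Phi_mx d (fun i => bit_row (y i))) < m)%N.
Proof.
rewrite !ltnNge; apply: contra => rank_ge.
have full : row_full (Phi_mx d (fun i => bit_row (y i))).
  by rewrite /row_full eqn_leq rank_leq_col.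
have minor := fullrowsub_unit full.
set f := fullrankfun full in minor.
have det0 : \det (rowsub f int_Phi_mx) != 0.
  apply: contraTneq minor => det0; rewrite unitmxE -int_Phi_mx_mod2.
  by rewrite -map_mxsub det_map_mx det0 rmorph0 unitr0.
have unitR : rowsub f (map_mx intr int_Phi_mx : 'M[R]_(D n d, m)) \in unitmx.
  by rewrite unitmxE -map_mxsub det_map_mx unitfE intr_eq0.
apply: (@leq_trans (\rank (rowsub f (map_mx intr int_Phi_mx : 'M[R]_(D n d, m))))).
  by rewrite mxrank_unit.
apply: leq_trans (mxrankS (rowsub_sub _ _)) _.
by rewrite -mxrank_tr int_Phi_mx_chi mxrankM_maxl.
Qed.

End OneMatrix.

Lemma card_rank_chi_le (n d m : nat) :
  (#|[set y : {ffun 'I_m -> 'rV[pm1 R]_n.-1} | (\rank (chi_mx d y) < m)%N]%SET| <=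
   #|[set z : {ffun 'I_m -> 'rV['F_2]_n.-1} | (\rank (Phi_mx d z) < m)%N]%SET|)%N.
Proof.
pose bits (y : {ffun 'I_m -> 'rV[pm1 R]_n.-1}) := [ffun i => bit_row (y i)].
have bits_inj : injective bits.
  move=> y y' /ffunP yy'; apply/ffunP => i; apply/rowP => j; apply: pm1_bit_inj.
  have := yy' i; rewrite !ffunE => /rowP/(_ j); rewrite !mxE.
  by case: (pm1_bit (y i 0 j)); case: (pm1_bit (y' i 0 j)).
rewrite -(card_imset _ bits_inj); apply: subset_leq_card.
apply/fintype.subsetP => z /imsetP[y]; rewrite !finset.in_set => rk ->.
have := rank_Phi_le_chi rk; congr (\rank _ < m)%N.
by apply/matrixP => k i; rewrite !mxE ffunE.
Qed.

End RealRank.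

Local Open Scope classical_set_scope.

(** Union bound over the values of the tuple. *)
Lemma prob_le_count (R : realType) (disp : measure_display)
    (T : measurableType disp) (P : probability T R) (V : finType) (m : nat)
    (X : 'I_m -> T -> V) (Q : pred {ffun 'I_m -> V}) :
    independent_uniform P X ->
  (P [set w | Q [ffun i => X i w]] <=
    (#|[set f | Q f]%SET|%:R / #|V|%:R ^+ m)%:E)%E.
Proof.
move=> [measX unifX indepX].
pose E (f : {ffun 'I_m -> V}) :=
  \bigcap_(i in [set i | i \in [set: 'I_m]%SET]) (X i @^-1` [set f i]).
have measE f : measurable (E f).
  by apply: fin_bigcap_measurable => [|i _]; [exact: finite_finset|exact: measX].
have probE f : P (E f) = ((#|V|%:R ^+ m)^-1)%:E.
  rewrite /E indepX (eq_bigr (fun=> (#|V|%:R^-1)%:E)) => [|i _]; last exact: unifX.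
  by rewrite prodEFin prodr_const cardsT card_ord exprVn.
have cover : [set w | Q [ffun i => X i w]] `<=`
    \big[setU/set0]_(f <- enum Q) E f.
  move=> w Qw; rewrite -bigcup_seq; exists [ffun i => X i w] => /=.
    by rewrite mem_enum.
  by move=> i _; rewrite /= ffunE.
have bound (s : seq {ffun 'I_m -> V}) :
    (P (\big[setU/set0]_(f <- s) E f) <= ((size s)%:R / #|V|%:R ^+ m)%:E)%E.
  elim: s => [|f s IHs]; first by rewrite big_nil measure0 mul0r.
  rewrite big_cons; apply: le_trans (measureU2 _ (measE f) _) _.
    by apply: bigsetU_measurable => g _.
  rewrite -natr1 mulrDl mul1r EFinD [X in (_ <= X)%E]addeC.
  by apply: leeD; [rewrite le_eqVlt; apply/orP; left; apply/eqP; exact: probE|exact: IHs].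
have -> : #|[set f | Q f]%SET| = size (enum Q).
  by rewrite cardsE cardE.
apply: le_trans (bound _); apply: le_measure => //; rewrite inE.
  rewrite (_ : [set w | _] = \big[setU/set0]_(f <- enum Q) E f).
    by apply: bigsetU_measurable => g _.
  apply/seteqP; split=> // w; rewrite -bigcup_seq => -[f /=].
  rewrite mem_enum => Qf Ew; rewrite (_ : [ffun i => _] = f) //.
  by apply/ffunP => i; rewrite ffunE; apply: (Ew i) => /=; rewrite finset.inE.
by apply: bigsetU_measurable => g _.
Qed.

Theorem proposition1p4 (R : realType) (d : nat) (d_ge1 : (1 <= d)%N) :
  exists C c : R, 0 < C /\ 0 < c /\
  exists N : nat, forall n : nat, (N <= n)%N ->
  forall m : nat, (1 <= m <= D n d)%N ->
    (forall (disp : measure_display) (T : measurableType disp)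
       (P : probability T R) (z : 'I_m -> T -> 'rV['F_2]_n.-1),
       independent_uniform P z ->
       (P [set w | (\rank (Phi_mx d (fun i => z i w)) < m)%N]
          <= (rank_bound C c n d m)%:E)%E)
    /\
    (forall (disp : measure_display) (T : measurableType disp)
       (P : probability T R) (y : 'I_m -> T -> 'rV[pm1 R]_n.-1),
       independent_uniform P y ->
       (P [set w | (\rank (chi_mx d (fun i => y i w)) < m)%N]
          <= (rank_bound C c n d m)%:E)%E).
Proof.
have [c [n0 [c0 bad_le]]] := bad_fraction_rank_bound R d_ge1.
exists 1, c; split=> //; split=> //; exists n0 => n n_ge m m_bounds.
have {}bad_le := bad_le n m n_ge m_bounds; split=> disp T P.
  move=> z z_unif.
  pose Q (f : {ffun 'I_m -> 'rV['F_2]_n.-1}) := (\rank (Phi_mx d f) < m)%N.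
  have := prob_le_count Q z_unif; rewrite card_F2row natrX => prob_le.
  rewrite (_ : [set w | _] = [set w | Q [ffun i => z i w]]).
    by apply: le_trans prob_le _; rewrite lee_fin.
  apply/seteqP; split=> w; rewrite /Q /=; congr (\rank _ < m)%N;
    by apply/matrixP => k i; rewrite !mxE ffunE.
move=> y y_unif.
pose Q (f : {ffun 'I_m -> 'rV[pm1 R]_n.-1}) := (\rank (chi_mx d f) < m)%N.
have := prob_le_count Q y_unif; rewrite card_mx card_pm1 mul1n natrX => prob_le.
rewrite (_ : [set w | _] = [set w | Q [ffun i => y i w]]).
  apply: le_trans prob_le _; rewrite lee_fin; apply: le_trans bad_le.
  by rewrite ler_pM2r ?invr_gt0 ?exprn_gt0 // ler_nat card_rank_chi_le.
apply/seteqP; split=> w; rewrite /Q /=; congr (\rank _ < m)%N;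
  by apply/matrixP => i k; rewrite !mxE ffunE.
Qed.
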